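(* Let $E\neq\{0\}$ be a Fréchet-Hilbert space. Then $E\cong s$ if and only if $E$ is isomorphic to a complemented subspace of $s$ and $E$ is normwise stable.
   Context: $s=\{x=(x_0,x_1,\dots): \lim_n x_n n^k=0 \text{ for all } k\in\mathbb{N}\}$ is the space of rapidly decreasing scalar sequences, a nuclear Fréchet space with the norms $\|x\|_k=\sup_n |x_n|(n+1)^k$, or equivalently with the hilbertian norms $|x|_k=\big(\sum_n|x_n|^2(n+1)^{2k}\big)^{1/2}$. A seminorm is hilbertian if it is induced by a semi-inner product; a Fréchet-Hilbert space is a Fréchet space whose topology is given by a fundamental system of hilbertian seminorms. The symbol $\cong$ and the word ''isomorphic'' between Fréchet spaces mean linear topological isomorphism. A complemented subspace of $s$ is the range of a continuous linear projection in $s$, with the induced topology. A Fréchet-Hilbert space $E$ is called normwise stable if it admits a fundamental system $\|\cdot\|_0\le\|\cdot\|_1\le\dots$ of hilbertian seminorms for which there are an isomorphism $\psi:E\oplus E\to E$ and constants $C_k>0$ such that $$\frac{1}{C_k}(\|x\|_k+\|y\|_k)\le\|\psi(x\oplus y)\|_k\le C_k(\|x\|_k+\|y\|_k)$$ for all $k$ and all $x,y\in E$. *)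

(* Defs.v *)
From HB Require Import structures.
From mathcomp Require Import all_boot all_order all_algebra sesquilinear complex.
From mathcomp Require Import all_classical all_reals all_analysis.

Set Implicit Arguments.
Unset Strict Implicit.
Unset Printing Implicit Defensive.

Import Order.TTheory GRing.Theory Num.Theory.
Import numFieldNormedType.Exports.

Local Open Scope classical_set_scope.
Local Open Scope ring_scope.

(** The scalars are either the reals or the complex numbers; [conj] is the
    conjugation used in sesquilinear forms (the identity on the reals). As in
    the library, norms and seminorms take their values in the nonnegative
    elements of [K]. *)
Inductive scalar_field (R : realType) :
    forall K : numFieldType, (K -> K) -> Prop :=
| real_scalars : @scalar_field R R idfun
| complex_scalars : @scalar_field R R[i] Num.conj.

HB.instance Definition _ (K : numDomainType) (E F : preTopologicalLmodType K) :=
  Topological.on (E * F)%type.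

Section Spaces.
Variable K : numFieldType.

Definition continuous_linear (E F : preTopologicalLmodType K) (f : E -> F) :=
  linear f /\ continuous f.

Definition isomorphism (E F : preTopologicalLmodType K) (f : E -> F) :=
  continuous_linear f /\
  exists g : F -> E, [/\ continuous g, cancel f g & cancel g f].

Definition isomorphic (E F : preTopologicalLmodType K) :=
  exists f : E -> F, isomorphism f.

(* [A] carries the topology induced by [F]. *)
Definition isomorphic_to_subspace
    (E F : preTopologicalLmodType K) (A : set F) :=
  exists f : E -> F, [/\ continuous_linear f, range f = A
    & exists g : F -> E, {within A, continuous g} /\ cancel f g].

Definition complemented (F : preTopologicalLmodType K) (A : set F) :=
  exists P : F -> F,
    [/\ continuous_linear P, forall x, P (P x) = P x & range P = A].

Record seminorm (E : lmodType K) (p : E -> K) : Prop := {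
  seminorm_ge0 : forall x, 0 <= p x;
  seminormD : forall x y, p (x + y) <= p x + p y;
  seminormZ : forall a x, p (a *: x) = `|a| * p x
}.

Definition hilbertian (conj : K -> K) (E : lmodType K) (p : E -> K) :=
  seminorm p /\
  exists h : {hermitian E for false & conj},
    (forall x, 0 <= h x x) /\ (forall x, p x ^+ 2 = h x x).

Definition fundamental_system (E : preTopologicalLmodType K)
    (p : nat -> E -> K) :=
  (forall k, seminorm (p k)) /\
  (forall U : set E, nbhs 0 U <->
    exists k e, 0 < e /\ [set x | p k x < e] `<=` U).

(* [topologicalLmodType] carries no uniformity: Cauchy filters are those of
   the additive group. *)
Definition complete_lmod (E : preTopologicalLmodType K) :=
  forall F : set_system E, ProperFilter F ->
    (forall U : set E, nbhs 0 U ->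
      exists2 A, F A & forall x y, A x -> A y -> U (x - y)) ->
    exists x : E, F --> x.

(* A countable fundamental system of seminorms expresses that [E] is locally
   convex and, being Hausdorff, metrizable. *)
Definition frechet (E : topologicalLmodType K) :=
  [/\ hausdorff_space E, complete_lmod E
    & exists p : nat -> E -> K, fundamental_system p].

Definition hilbertian_system (conj : K -> K) (E : preTopologicalLmodType K)
    (p : nat -> E -> K) :=
  fundamental_system p /\ forall k, hilbertian conj (p k).

Definition frechet_hilbert (conj : K -> K) (E : topologicalLmodType K) :=
  frechet E /\ exists p : nat -> E -> K, hilbertian_system conj p.

Definition normwise_stable (conj : K -> K) (E : topologicalLmodType K) :=
  exists p : nat -> E -> K,
    [/\ hilbertian_system conj p,
        forall k x, p k x <= p k.+1 x
      & exists (psi : E * E -> E) (C : nat -> K),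
          [/\ isomorphism psi, forall k, 0 < C k
            & forall k x y,
              (C k)^-1 * (p k x + p k y) <= p k (psi (x, y))
                                         <= C k * (p k x + p k y)]].

Definition rapidly_decreasing : pred (nat -> K^o) := fun x =>
  `[< forall k, x n * n%:R ^+ k @[n --> \oo] --> (0 : K) >].

Lemma rapidly_decreasing_submod : submod_closed rapidly_decreasing.
Proof.
split=> [|a x y /asboolP hx /asboolP hy]; apply/asboolP => k.
  rewrite (_ : (fun n => _) = cst 0); first exact: cvg_cst.
  by apply/funext => n /=; rewrite mul0r.
rewrite (_ : (fun n => _) =
  (fun n => a * (x n * n%:R ^+ k) + y n * n%:R ^+ k)); last first.
  by apply/funext => n /=; rewrite mulrDl -mulrA.
rewrite [X in _ --> X](_ : 0 = a * 0 + 0); last by rewrite mulr0 addr0.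
apply: (@cvgD _ K^o) => //; apply: cvgM => //; exact: cvg_cst.
Qed.

HB.instance Definition _ :=
  GRing.isSubmodClosed.Build K (nat -> K^o) rapidly_decreasing
    rapidly_decreasing_submod.

Record s := MkS { s_val :> nat -> K^o; s_valP : s_val \in rapidly_decreasing }.

HB.instance Definition _ := [isSub for s_val].
HB.instance Definition _ := [Choice of s by <:].
HB.instance Definition _ := [SubChoice_isSubLmodule of s by <:].

(* The [y] with ||y - x||_k <= e, where ||x||_k = sup_n |x_n| (n+1)^k. *)
Definition s_ball (x : s) (k : nat) (e : K) : set s :=
  [set y | forall n, `|y n - x n| * n.+1%:R ^+ k <= e].

Definition s_nbhs (x : s) : set_system s :=
  [set U | exists k e, 0 < e /\ s_ball x k e `<=` U].

HB.instance Definition _ := hasNbhs.Build s s_nbhs.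

Lemma s_ballS x k l e d :
  (k <= l)%N -> d <= e -> s_ball x l d `<=` s_ball x k e.
Proof.
move=> kl de y hy n; apply: le_trans de; apply: le_trans (hy n).
by rewrite ler_wpM2l// ler_weXn2l// ler1n.
Qed.

Lemma s_ball_refl x k e : 0 <= e -> s_ball x k e x.
Proof. by move=> e0 n; rewrite subrr normr0 mul0r. Qed.

Lemma s_ball_split x y z k e d :
  s_ball x k e y -> s_ball y k d z -> s_ball x k (e + d) z.
Proof.
move=> xy yz n; apply: le_trans (lerD (xy n) (yz n)).
rewrite -mulrDl ler_wpM2r ?exprn_ge0//; apply: le_trans (ler_normD _ _).
by rewrite [X in _ <= `|X|]addrC subrKA.
Qed.

Lemma s_ball_shift x k e y : s_ball x k e y <-> s_ball 0 k e (y - x).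
Proof. by split=> h n; move: (h n); rewrite /= subr0. Qed.

Lemma s_nbhs_filter (x : s) : ProperFilter (nbhs x).
Proof.
split; first by move=> [k [e [e0 sU]]]; apply: (sU x); exact/s_ball_refl/ltW.
split.
- by exists 0%N, 1; split.
- move=> U V [k [e [e0 sU]]] [l [d [d0 sV]]].
  have ed : e >=< d by apply: real_comparable; exact: gtr0_real.
  exists (maxn k l), (Num.min e d); split.
    by rewrite comparable_lt_min// e0.
  move=> y hy; split; [apply: sU|apply: sV]; move: hy; apply: s_ballS.
  + exact: leq_maxl.
  + by rewrite comparable_ge_min// lexx.
  + exact: leq_maxr.
  + by rewrite comparable_ge_min// lexx orbT.
- move=> U V UV [k [e [e0 sU]]]; exists k, e; split=> //.
  exact: subset_trans UV.
Qed.

Lemma s_nbhs_singleton (x : s) (U : set s) : nbhs x U -> U x.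
Proof. by move=> [k [e [e0 sU]]]; apply/sU/s_ball_refl/ltW. Qed.

Lemma s_nbhs_nbhs (x : s) (U : set s) : nbhs x U -> nbhs x (nbhs^~ U).
Proof.
move=> [k [e [e0 sU]]]; exists k, (e / 2); split; first exact: divr_gt0.
move=> y xy; exists k, (e / 2); split; first exact: divr_gt0.
by move=> z yz; apply: sU; rewrite [e]splitr; exact: s_ball_split xy yz.
Qed.

HB.instance Definition _ := Nbhs_isNbhsTopological.Build s
  s_nbhs_filter s_nbhs_singleton s_nbhs_nbhs.

Lemma s_add_continuous : continuous (fun x : s * s => x.1 + x.2).
Proof.
move=> [x y] U [k [e [e0 sU]]].
have e20 : 0 < e / 2 by exact: divr_gt0.
exists (s_ball x k (e / 2), s_ball y k (e / 2)).
  by split; exists k, (e / 2); split.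
move=> [u v] /= [xu yv]; apply: sU => n; rewrite /= [e]splitr.
apply: le_trans (lerD (xu n) (yv n)).
rewrite -mulrDl ler_wpM2r// ?exprn_ge0//.
by rewrite opprD addrACA ler_normD.
Qed.

Lemma s_bounded (x : s) k :
  exists2 M, 0 < M & forall n, `|x n| * n.+1%:R ^+ k <= M.
Proof.
have /asboolP/(_ k)/cvgr0Pnorm_lt/(_ 1 ltr01)[N _ hN] := s_valP x.
pose S := \sum_(i < N.+1) `|x i| * i.+1%:R ^+ k.
have S0 : 0 <= S by apply: sumr_ge0 => i _; rewrite mulr_ge0// exprn_ge0.
exists (S + 2 ^+ k) => [|n]; first by rewrite ltr_wpDl// exprn_gt0.
have [nN|Nn] := ltnP n N.+1.
  rewrite ler_wpDr ?exprn_ge0// /S (bigD1 (Ordinal nN))//= lerDl.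
  by apply: sumr_ge0 => i _; rewrite mulr_ge0// exprn_ge0.
rewrite ler_wpDl//.
apply: (@le_trans _ _ (`|x n| * (2 * n%:R) ^+ k)).
  rewrite ler_wpM2l// lerXn2r ?nnegrE ?mulr_ge0//.
  rewrite -natrM ler_nat mul2n -addnn -addn1 leq_add2l.
  exact: leq_ltn_trans Nn.
rewrite exprMn mulrCA ler_piMr ?exprn_ge0//.
have := hN n (ltnW Nn).
by rewrite /= normrM normrX normr_nat => /ltW.
Qed.

Lemma s_scale_continuous : continuous (fun z : K^o * s => z.1 *: z.2).
Proof.
move=> [a x] U [k [e [e0 sU]]].
have [M M0 hM] := s_bounded x k.
pose d := e / 2 / M; pose c := e / 2 / (`|a| + 1).
have a10 : 0 < `|a| + 1 by rewrite ltr_wpDl.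
have d0 : 0 < d by rewrite !divr_gt0.
have c0 : 0 < c by rewrite !divr_gt0.
exists ([set b : K^o | `|a - b| < 1] `&` [set b : K^o | `|a - b| < d],
        s_ball x k c).
  split; last by exists k, c; split.
  by apply: filterI; exact: (@nbhsx_ballx _ K^o).
move=> [b y] /= [[ab1 abd] xy]; apply: sU => n /=.
have -> : b * y n - a * x n = b * (y n - x n) + (b - a) * x n.
  by rewrite mulrBr mulrBl addrA subrK.
apply: (@le_trans _ _ (`|b| * (`|y n - x n| * n.+1%:R ^+ k) +
                       `|b - a| * (`|x n| * n.+1%:R ^+ k))).
  by rewrite !mulrA -mulrDl ler_wpM2r ?exprn_ge0// -!normrM ler_normD.
rewrite [e]splitr; apply: lerD.
  rewrite -[leRHS](divfK (lt0r_neq0 a10)) [leRHS]mulrC.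
  apply: ler_pM => //.
  rewrite -lerBlDl; apply: le_trans (ltW ab1).
  by rewrite distrC lerB_dist.
rewrite -[leRHS](divfK (lt0r_neq0 M0)).
apply: ler_pM => //.
by rewrite distrC ltW.
Qed.

HB.instance Definition _ :=
  PreTopologicalNmodule_isTopologicalNmodule.Build s s_add_continuous.
HB.instance Definition _ :=
  TopologicalNmodule_isTopologicalLmodule.Build K s s_scale_continuous.

End Spaces.

(* Main.v *)
Require Import Defs.
From Stdlib Require Cantor.
From mathcomp Require Import zify ring.
From HB Require Import structures.
From mathcomp Require Import all_boot all_order all_algebra sesquilinear complex.
From mathcomp Require Import all_classical all_reals all_analysis.

(** If [E] is isomorphic to [s], only normwise stability has to be shown, and it
    is enough to show it for [s] with the norms
    |x|_k = (sum |x_n|^2 (n+1)^(2k))^(1/2). Merging two sequences into the even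
    and the odd positions is an isomorphism of the square of [s] with [s], and it
    changes the weight (n+1)^k of an entry by a factor between 1 and 2^k
    ([s_norm_interleave]).

    Conversely let [E] be complemented in [s], with embedding [j] and left inverse
    [pi], and normwise stable, with seminorms p_k. If [s] is also complemented
    in [E], then Pelczynski's decomposition method gives the isomorphism
    ([pelczynski_decomposition]): E is isomorphic to E x s because [s] is its own
    square, and E x s is isomorphic to [s] by a swindle in the space of rapidly
    decreasing double sequences, which is [s] again since the Cantor pairing grows
    polynomially.

    It remains to find a complemented copy of [s] in [E]. Starting from one vector
    v with p_k1(v) > 0, the map [psi] produces subspaces of dimension N = 2^m on
    which each p_k is, up to the factor C_k^m, a multiple of the l1 norm of the
    coordinates ([cube_subspace]). As C_k^m is a power of N, every vector of this
    subspace with p_k1 equal to 1 has p_k bounded by a power of N: its choice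
    is free, and linear algebra provides one that is orthogonal, for the inner
    product of p_k1, to any given N - 1 vectors. In this way one chooses, with N of
    the order of n, a vector x_n orthogonal to x_0, ..., x_(n-1) and to the images
    under [pi] of the first n unit sequences ([orthogonal_sequence]).

    Then a |-> sum a_n x_n maps [s] continuously to [E], because the x_n grow
    polynomially ([synthesis_map]). The coefficient <z, x_n> is unchanged when the
    first n coordinates of j z are replaced by zero, so it decreases rapidly, and
    z |-> (<z, x_n>)_n maps [E] continuously to [s] ([coefficient_map]). By
    orthonormality the second map is a left inverse of the first. *)

Set Implicit Arguments.
Unset Strict Implicit.
Unset Printing Implicit Defensive.

Import Order.TTheory GRing.Theory Num.Theory.
Import numFieldNormedType.Exports.

Local Open Scope classical_set_scope.
Local Open Scope ring_scope.

(** * Scalars *)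

Section Bounds.
Variable K : numFieldType.

(** The right-hand side telescopes, since 1/(i+1)^2 <= 2/(i+1) - 2/(i+2). All
    sums below are dominated by this one. *)
Lemma sum_inv_sqr_le (m n : nat) : (m <= n)%N ->
  \sum_(m <= i < n) (i.+1%:R ^+ 2)^-1 <= 2 / m.+1%:R - 2 / n.+1%:R :> K.
Proof.
move=> mn; rewrite -(subnKC mn); elim: (n - m)%N => [|d ih].
  by rewrite addn0 big_geq// subrr.
rewrite addnS big_nat_recr ?leq_addr//=.
set N := (m + d)%N in ih *.
apply: le_trans (lerD ih (lexx _)) _.
rewrite -addrA lerD2l.
rewrite addrC lerBlDr addrC -lerBlDr opprK.
have N1 : (0 : K) < N.+1%:R by rewrite ltr0n.
have N2 : (0 : K) < N.+2%:R by rewrite ltr0n.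
rewrite -[X in X + _]mul1r addf_div ?expf_neq0 ?gt_eqF//.
rewrite ler_pdivrMr ?mulr_gt0 ?exprn_gt0//.
rewrite mulrAC ler_pdivlMr// mul1r -!natrX -!natrM -natrD -natrM ler_nat.
by rewrite expnS expn1; nia.
Qed.

Lemma ler_sqr_nneg (x y : K) :
  0 <= x -> 0 <= y -> (x <= y) = (x ^+ 2 <= y ^+ 2).
Proof. by move=> x0 y0; rewrite ler_pXn2r. Qed.

Lemma ge0_small_eq0 (x : K) :
  0 <= x -> (forall e, 0 < e -> x <= e) -> x = 0.
Proof.
move=> x0 xe; apply/eqP; apply: contraT => xn0.
have xp : 0 < x by rewrite lt_neqAle eq_sym xn0.
have := xe (x / 2); rewrite divr_gt0// => /(_ isT).
by rewrite ler_pdivlMr// ger_pMr// lern1.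
Qed.

End Bounds.

(** What is used of the map [conj]; it covers the identity of the reals and
    complex conjugation at once. *)
Definition conjugation (K : numFieldType) (conj : K -> K) :=
  [/\ forall x y, conj (x - y) = conj x - conj y,
      forall x y, conj (x * y) = conj x * conj y,
      involutive conj
    & forall x, x * conj x = `|x| ^+ 2].

Section Scalars.
Variable R : realType.
Local Open Scope complex_scope.

Lemma scalar_archimedean (K : numFieldType) (conj : K -> K) :
  scalar_field R conj -> forall x : K, exists n : nat, `|x| <= n%:R.
Proof.
case=> x.
  by exists (Num.bound `|x|); apply/ltW/archi_boundP.
have /complex_realP[r xr] : `|x| \is Num.real by [].
have r0 : 0 <= r by rewrite -ler0c -xr.
exists (Num.bound r); rewrite xr -(rmorph_nat (real_complex R)) lecR.
exact/ltW/archi_boundP.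
Qed.

Lemma scalar_conj (K : numFieldType) (conj : K -> K) :
  scalar_field R conj -> conjugation conj.
Proof.
case; split=> // x; do ?[by move=> y; rewrite ?rmorphB ?rmorphM].
- by rewrite -expr2 real_normK ?num_real.
- exact: conjCK.
- by rewrite normCK.
Qed.

Lemma scalar_sqrt (K : numFieldType) (conj : K -> K) : scalar_field R conj ->
  forall x : K, 0 <= x -> exists2 y, 0 <= y & y ^+ 2 = x.
Proof.
case=> x x0.
  by exists (Num.sqrt x); rewrite ?sqrtr_ge0 ?sqr_sqrtr.
by exists (sqrtC x); rewrite ?sqrtC_ge0 ?sqrtCK.
Qed.

(** The real case of [scalar_series_cvg], to which the real and imaginary parts
    of a complex series reduce. *)
Lemma real_series_cvg (u : nat -> R) (M : R) :
  (forall n, `|u n| <= M / n.+1%:R ^+ 2) -> cvgn (series u).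
Proof.
move=> uM; apply: normed_cvg.
have M0 : 0 <= M.
  by have := le_trans (normr_ge0 _) (uM 0%N); rewrite expr1n divr1.
apply: nondecreasing_is_cvgn.
  apply: nondecreasing_series => n _ _; exact: normr_ge0.
exists (M * 2) => _ [n _ <-]; rewrite /series/=.
apply: (@le_trans _ _ (\sum_(0 <= i < n) M * (i.+1%:R ^+ 2)^-1)).
  by apply: ler_sum => i _; exact: uM.
rewrite -mulr_sumr ler_wpM2l//.
apply: le_trans (sum_inv_sqr_le R (leq0n n)) _.
by rewrite divr1 lerBlDr lerDl divr_ge0.
Qed.

Lemma normc_le_ReIm (z : R[i]) :
  `|z| <= `|complex.Re z|%:C + `|complex.Im z|%:C.
Proof.
rewrite [in leLHS](complexE z); apply: le_trans (ler_normD _ _) _.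
rewrite normrM complexiE normCi mul1r !normc_def/= !expr0n/= !addr0.
by rewrite !sqrtr_sqr lexx.
Qed.

Lemma normc_ge_Im (z : R[i]) : `|complex.Im z|%:C <= `|z|.
Proof.
by rewrite normc_def lecR -sqrtr_sqr ler_wsqrtr// lerDr sqr_ge0.
Qed.

Lemma scalar_series_cvg (K : numFieldType) (conj : K -> K) :
  scalar_field R conj -> forall (u : nat -> K) (M : K),
  (forall n, `|u n| <= M / n.+1%:R ^+ 2) -> cvg (series u @ \oo).
Proof.
case=> u M uM; first exact: real_series_cvg uM.
have M0 : 0 <= M.
  by have := le_trans (normr_ge0 _) (uM 0%N); rewrite expr1n divr1.
have /complex_realP[m Mm] : M \is Num.real by exact: ger0_real.
have part (f : R[i] -> R) : (forall z, `|f z|%:C <= `|z|) ->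
    cvgn (series (f \o u)).
  move=> fz; apply: (@real_series_cvg _ m) => n.
  rewrite -lecR; apply: le_trans (fz _) _; apply: le_trans (uM n) _.
  by rewrite Mm -(rmorph_nat (real_complex R)) -rmorphXn -fmorphV -rmorphM.
have /cvg_ex[a ha] := part _ (@normc_ge_Re R).
have /cvg_ex[b hb] := part _ normc_ge_Im.
apply/cvg_ex; exists (a +i* b)%C; apply/cvgrPdist_lt => e e0.
have /complex_realP[d ed] : e \is Num.real by exact: gtr0_real.
have d20 : 0 < d / 2 by rewrite divr_gt0// -ltcR -ed.
move: ha hb => /cvgrPdist_lt/(_ _ d20) ha /cvgrPdist_lt/(_ _ d20) hb.
near=> n.
apply: le_lt_trans (normc_le_ReIm _) _.
rewrite ed (splitr d) rmorphD/=.
apply: ltrD; rewrite ltcR.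
- rewrite (_ : complex.Re _ =
    a - series (@complex.Re R \o u) n); first by near: n.
  rewrite raddfB/=; congr (_ - _); exact: raddf_sum.
- rewrite (_ : complex.Im _ =
    b - series (@complex.Im R \o u) n); first by near: n.
  rewrite raddfB/=; congr (_ - _); exact: raddf_sum.
Unshelve. all: by end_near. Qed.

End Scalars.

(** * Topological modules and seminorms *)

Section TopologicalModules.
Variable K : numFieldType.
Implicit Types E F : topologicalLmodType K.

Section LinearFunctions.
Variables (E F : lmodType K) (f : E -> F).
Hypothesis lf : linear f.

Lemma linear_fun0 : f 0 = 0.
Proof. by rewrite -(subrr 0) (zmod_morphism_linear lf) subrr. Qed.

Lemma linear_funD x y : f (x + y) = f x + f y.
Proof. by rewrite -[x]scale1r lf !scale1r. Qed.

Lemma linear_funN x : f (- x) = - f x.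
Proof. by rewrite -[- x]sub0r (zmod_morphism_linear lf) linear_fun0 sub0r. Qed.

Lemma linear_fun_sum (I : Type) (r : seq I) (P : pred I) (G : I -> E) :
  f (\sum_(i <- r | P i) G i) = \sum_(i <- r | P i) f (G i).
Proof. exact: (big_morph f linear_funD linear_fun0). Qed.

End LinearFunctions.

Lemma shift_continuous E (a : E) : continuous (fun x => a + x).
Proof.
move=> x; apply: (@continuous_comp _ (E * E)%type _ (fun x => (a, x))
  (fun z => z.1 + z.2)); last exact: add_continuous.
by apply: cvg_pair; [exact: cvg_cst|exact: cvg_id].
Qed.

(** Both neighbourhood filters are translates of the filters at zero. *)
Lemma linear_continuous0 E F (f : E -> F) : linear f ->
  (forall U, nbhs (0 : F) U -> nbhs (0 : E) (f @^-1` U)) -> continuous f.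
Proof.
move=> lf f0 x U fxU.
have fB := zmod_morphism_linear lf.
have := @shift_continuous F (f x) 0 U; rewrite addr0 => /(_ fxU) /f0 h.
have := @shift_continuous E (- x) x.
rewrite /continuous_at addNr => /(_ _ h) hx.
have {}hx : nbhs x [set u | U (f x + f (- x + u))] by [].
suff : nbhs x (f @^-1` U) by [].
by apply: filterS hx => u /=; rewrite [- x + u]addrC fB addrC subrK.
Qed.

Lemma continuous_linear0 E F (f : E -> F) : continuous_linear f ->
  forall U, nbhs (0 : F) U -> nbhs (0 : E) (f @^-1` U).
Proof.
move=> [lf cf] U U0.
by apply: cf; rewrite (linear_fun0 lf).
Qed.

Lemma continuous_linearD E F (f g : E -> F) :
  continuous_linear f -> continuous_linear g ->
  continuous_linear (fun x => f x + g x).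
Proof.
move=> [lf cf] [lg cg]; split.
  by move=> a x y; rewrite lf lg scalerDr addrACA.
move=> x; apply: (@continuous_comp _ (F * F)%type _ (fun x => (f x, g x))
  (fun z => z.1 + z.2)); last exact: add_continuous.
by apply: cvg_pair; [exact: cf|exact: cg].
Qed.

Lemma continuous_linearN E F (f : E -> F) :
  continuous_linear f -> continuous_linear (fun x => - f x).
Proof.
move=> [lf cf]; split; first by move=> a x y; rewrite lf opprD scalerN.
move=> x; apply: (@continuous_comp _ _ _ f -%R) => //; first exact: cf.
exact: opp_continuous.
Qed.

Lemma continuous_linear_comp (E F G : preTopologicalLmodType K)
    (f : E -> F) (g : F -> G) :
  continuous_linear f -> continuous_linear g -> continuous_linear (g \o f).
Proof.
move=> [lf cf] [lg cg]; split; first by move=> a x y /=; rewrite lf lg.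
by move=> x; apply: continuous_comp; [exact: cf|exact: cg].
Qed.

Lemma continuous_linear_id (E : preTopologicalLmodType K) :
  continuous_linear (@id E).
Proof. by split=> // x; exact: cvg_id. Qed.

(** Continuity of [t |-> t *: v] at zero. *)
Lemma absorbing E (U : set E) (v : E) :
  nbhs 0 U -> exists2 t : K, 0 < t & U (t *: v).
Proof.
move=> U0; have := @scale_continuous K E (0, v) U.
rewrite /= scale0r => /(_ U0)[[A B] [/= A0 Bv] AB].
have [e /= e0 eA] := A0.
exists (e / 2); first by rewrite divr_gt0.
apply: (AB (e / 2, v)); split => /=; last exact: nbhs_singleton.
apply: eA => /=; rewrite sub0r normrN gtr0_norm ?divr_gt0//.
by rewrite ltr_pdivrMr// ltr_pMr// ltr1n.
Qed.

Section Seminorms.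
Variables (E : lmodType K) (p : E -> K).
Hypothesis sp : seminorm p.

Lemma seminorm0 : p 0 = 0.
Proof. by rewrite -(scale0r 0) (seminormZ sp) normr0 mul0r. Qed.

Lemma seminormN x : p (- x) = p x.
Proof. by rewrite -scaleN1r (seminormZ sp) normrN1 mul1r. Qed.

Lemma seminorm_sum (I : Type) (r : seq I) (P : pred I) (F : I -> E) :
  p (\sum_(i <- r | P i) F i) <= \sum_(i <- r | P i) p (F i).
Proof.
elim/big_rec2: _ => [|i y x _ h]; first by rewrite seminorm0.
by apply: le_trans (seminormD sp _ _) _; rewrite lerD2l.
Qed.

End Seminorms.

Lemma seminorm_comp (E F : lmodType K) (f : E -> F) (q : F -> K) :
  linear f -> seminorm q -> seminorm (q \o f).
Proof.
move=> lf sq.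
split=> [x|x y|a x] /=; first exact: seminorm_ge0.
  by rewrite (linear_funD lf); exact: seminormD.
by rewrite (scalable_linear lf) (seminormZ sq).
Qed.

Lemma fundamental_nbhs E (p : nat -> E -> K) k e : fundamental_system p ->
  0 < e -> nbhs 0 [set x | p k x < e].
Proof. by move=> [_ fp] e0; apply/fp; exists k, e; split. Qed.

End TopologicalModules.

(** * Continuous linear maps into and out of the sequence space *)

Section SequenceSpace.
Variable K : numFieldType.
Hypothesis archimedean : forall x : K, exists n : nat, `|x| <= n%:R.
Implicit Types E : topologicalLmodType K.

Lemma s_eqP (x y : s K) : (forall n, x n = y n) <-> x = y.
Proof. by split=> [xy|->//]; apply/val_inj/funext. Qed.

Lemma nbhs_s_ball k (e : K) : 0 < e -> nbhs 0 (s_ball (0 : s K) k e).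
Proof. by move=> e0; exists k, e; split. Qed.

Lemma s_ball0 k (e : K) (x : s K) :
  s_ball 0 k e x <-> forall n, `|x n| * n.+1%:R ^+ k <= e.
Proof. by split=> h n; have := h n; rewrite /= subr0. Qed.

(** A bound for the exponent k+1 gives convergence to zero for the exponent k. *)
Lemma bounded_rapidly_decreasing (x : nat -> K^o) :
  (forall k, exists M, forall n, `|x n| * n.+1%:R ^+ k <= M) ->
  x \in @rapidly_decreasing K.
Proof.
move=> bx; apply/asboolP => k.
have [M hM] := bx k.+1.
have M0 : 0 <= M by apply: le_trans (hM 0%N); rewrite mulr_ge0// exprn_ge0.
apply/cvgr0Pnorm_le => e e0.
have [N MN] := archimedean (M / e).
exists N => // n /= Nn.
rewrite normrM normrX normr_nat.
apply: (@le_trans _ _ (`|x n| * n.+1%:R ^+ k)).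
  by rewrite ler_wpM2l// lerXn2r ?nnegrE// ler_nat.
have n1 : (0 : K) < n.+1%:R by rewrite ltr0n.
rewrite -(ler_pM2r n1) -mulrA -exprSr; apply: le_trans (hM n) _.
rewrite -ler_pdivrMl// mulrC; apply: le_trans (real_ler_norm _) _.
  by rewrite ger0_real// divr_ge0// ltW.
by apply: le_trans MN _; rewrite ler_nat; exact: leqW.
Qed.

(** A family of functionals defines a continuous map into [s] as soon as it is
    equicontinuous after multiplication by any power of the index. That the
    values are rapidly decreasing comes for free: a multiple of each vector lies
    in the neighbourhoods given by the hypothesis. All maps into [s] below are
    built in this way. *)
Lemma s_valued_map E (phi : nat -> E -> K^o) : (forall n, linear (phi n)) ->
  (forall k e, 0 < e ->
    nbhs 0 [set v | forall n, `|phi n v| * n.+1%:R ^+ k <= e]) ->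
  exists f : E -> s K, continuous_linear f /\ forall v n, f v n = phi n v.
Proof.
move=> lphi cphi.
have rphi v : (fun n => phi n v) \in @rapidly_decreasing K.
  apply: bounded_rapidly_decreasing => k.
  have [t t0 tv] := absorbing v (cphi k 1 ltr01).
  exists t^-1 => n; have := tv n.
    rewrite (scalable_linear (lphi n)) normrM gtr0_norm// -mulrA.
  by rewrite -ler_pdivlMl// mulr1.
exists (fun v => MkS (rphi v)); split => //.
have lf : linear (fun v => MkS (rphi v)).
  by move=> a x y; apply/s_eqP => n /=; rewrite lphi.
split=> //; apply: linear_continuous0 => // U [k [e [e0 sU]]].
apply: filterS (cphi k e e0) => v hv /=.
by apply: sU; apply/s_ball0.
Qed.

Lemma s_ballZ k (e t : K) (x : s K) :
  0 < t -> s_ball 0 k e x -> s_ball 0 k (t * e) (t *: x).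
Proof.
move=> t0 /s_ball0 h; apply/s_ball0 => n /=.
by rewrite normrM gtr0_norm// -mulrA ler_pM2l.
Qed.

(** Continuity rescaled. The sup norms of [s] enter through the balls [s_ball],
    which avoids taking suprema in [K]. *)
Lemma continuous_bound_of_s E (q : nat -> E -> K) (f : s K -> E) :
  fundamental_system q -> continuous_linear f ->
  forall k, exists l C, 0 < C /\
    forall M x, 0 < M -> s_ball 0 l M x -> q k (f x) <= C * M.
Proof.
move=> fq cf k.
have [l [e [e0 le]]] := continuous_linear0 cf (fundamental_nbhs k fq ltr01).
exists l, e^-1; split; first by rewrite invr_gt0.
move=> M x M0 xM.
have eM : 0 < e / M by rewrite divr_gt0.
have := s_ballZ eM xM; rewrite divfK ?gt_eqF// => /le/= /ltW.
rewrite (scalable_linear cf.1) (seminormZ (fq.1 k)) gtr0_norm//.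
rewrite -ler_pdivlMl// mulr1.
by rewrite invf_div mulrC.
Qed.

End SequenceSpace.

(** * Topological direct sums *)

Section Isomorphisms.
Variable K : numFieldType.

Lemma isomorphic_sym (E F : preTopologicalLmodType K) :
  isomorphic E F -> isomorphic F E.
Proof.
move=> [f [[lf cf] [g [cg fK gK]]]]; exists g; split; last by exists f.
by split=> // a x y; apply: (can_inj fK); rewrite lf !gK.
Qed.

Lemma isomorphic_trans (E F G : preTopologicalLmodType K) :
  isomorphic E F -> isomorphic F G -> isomorphic E G.
Proof.
move=> [f [clf [f' [cf' fK f'K]]]] [g [clg [g' [cg' gK g'K]]]].
exists (g \o f); split; first exact: continuous_linear_comp.
exists (f' \o g'); split.
- by move=> x; apply: continuous_comp; [exact: cg'|exact: cf'].
- by move=> x /=; rewrite gK fK.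
- by move=> x /=; rewrite f'K g'K.
Qed.

Lemma continuous_pair_map (E F G H : topologicalType)
    (f : E -> G) (g : F -> H) :
  continuous f -> continuous g ->
  continuous (fun z : E * F => (f z.1, g z.2)).
Proof.
move=> cf cg z; apply: cvg_pair.
  by apply: continuous_comp; [exact: cvg_fst|exact: cf].
by apply: continuous_comp; [exact: cvg_snd|exact: cg].
Qed.

(** The usual criterion for a direct sum: injections [f1], [f2] and projections
    [g1], [g2]. *)
Lemma prod_isomorphism (E F G : topologicalLmodType K)
    (f1 : E -> G) (f2 : F -> G) (g1 : G -> E) (g2 : G -> F) :
  continuous_linear f1 -> continuous_linear f2 ->
  continuous_linear g1 -> continuous_linear g2 ->
  (forall x y, g1 (f1 x + f2 y) = x) -> (forall x y, g2 (f1 x + f2 y) = y) ->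
  (forall z, f1 (g1 z) + f2 (g2 z) = z) ->
  @isomorphism K (E * F)%type G (fun z => f1 z.1 + f2 z.2).
Proof.
move=> [lf1 cf1] [lf2 cf2] [lg1 cg1] [lg2 cg2] gf1 gf2 fg; split; first split.
- by move=> a x y /=; rewrite lf1 lf2 scalerDr addrACA.
- move=> z; apply: (@continuous_comp _ (G * G)%type _
    (fun z : E * F => (f1 z.1, f2 z.2)) (fun z => z.1 + z.2)).
    exact: continuous_pair_map.
  exact: add_continuous.
- exists (fun z => (g1 z, g2 z)); split => [z|[x y]|z] /=.
  + by apply: cvg_pair; [exact: cg1|exact: cg2].
  + by rewrite gf1 gf2.
  + exact: fg.
Qed.

End Isomorphisms.

(** * Rapidly decreasing double sequences *)

Section Reindexing.
Variable K : numFieldType.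
Hypothesis archimedean : forall x : K, exists n : nat, `|x| <= n%:R.
Implicit Types E : topologicalLmodType K.

(** Moving an entry to a smaller index only decreases the norms. *)
Lemma s_reindex (phi : nat -> nat) : (forall n, n <= phi n)%N ->
  exists f : s K -> s K, continuous_linear f /\ forall x n, f x n = x (phi n).
Proof.
move=> nphi; apply: (s_valued_map archimedean
  (phi := fun n (x : s K) => x (phi n))) => // k e e0.
apply: filterS (nbhs_s_ball k e0) => x /s_ball0 h n /=.
apply: le_trans (h (phi n)).
by rewrite ler_wpM2l// lerXn2r ?nnegrE// ler_nat ltnS.
Qed.

(** Moving the entry of index n to 2n or 2n+1 multiplies the k-th norm by at
    most 2^k. *)
Lemma s_spread (b : bool) : exists f : s K -> s K, continuous_linear f /\
  forall x n, f x n = if odd n == b then x n./2 else 0.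
Proof.
apply: (s_valued_map archimedean
  (phi := fun n (x : s K) => if odd n == b then x n./2 else 0)).
  by move=> n a x y; case: ifP => // _; rewrite scaler0 addr0.
move=> k e e0; have e2 : 0 < e / 2 ^+ k by rewrite divr_gt0 ?exprn_gt0.
apply: filterS (nbhs_s_ball k e2) => x /s_ball0 h n /=.
case: ifP => _; last by rewrite normr0 mul0r ltW.
rewrite -[leRHS](divfK (x := 2 ^+ k)) ?expf_neq0//.
apply: le_trans (ler_wpM2r _ (h n./2)); last by rewrite exprn_ge0.
rewrite -mulrA -exprMn ler_wpM2l// lerXn2r ?nnegrE ?mulr_ge0//.
by rewrite -natrM ler_nat; lia.
Qed.

(** The square of [s] is [s]: [A x + B y] has the entries of [x] at the even and
    those of [y] at the odd positions. *)
Lemma s_interleave : exists A B A' B' : s K -> s K,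
  [/\ continuous_linear A, continuous_linear B, continuous_linear A'
    & continuous_linear B'] /\
  [/\ forall x y, A' (A x + B y) = x, forall x y, B' (A x + B y) = y,
      forall z, A (A' z) + B (B' z) = z
    & forall x y n, (A x + B y) n.*2 = x n /\ (A x + B y) n.*2.+1 = y n].
Proof.
have [A [cA eA]] := s_spread false.
have [B [cB eB]] := s_spread true.
have [A' [cA' eA']] := @s_reindex double (fun n => ltac:(lia)).
have [B' [cB' eB']] := @s_reindex (fun n => n.*2.+1) (fun n => ltac:(lia)).
have eAB x y n : (A x + B y) n.*2 = x n /\ (A x + B y) n.*2.+1 = y n.
  have -> m : (A x + B y) m = A x m + B y m by [].
  have -> m : (A x + B y) m = A x m + B y m by [].
  rewrite !eA !eB /= odd_double/= uphalf_double doubleK.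
  by rewrite addr0 add0r.
exists A, B, A', B'; split => //; split => // [x y|x y|z]; apply/s_eqP => n.
- by rewrite eA' (eAB x y n).1.
- by rewrite eB' (eAB x y n).2.
- rewrite -(odd_double_half n); case: (odd n); rewrite ?add1n ?add0n.
    by rewrite (eAB _ _ _).2 eB'.
  by rewrite (eAB _ _ _).1 eA'.
Qed.

(** The Cantor pairing is bounded by a polynomial in both arguments, and bounds
    both; hence it identifies rapidly decreasing double sequences with [s]. *)
Definition pair_index (i n : nat) : nat := Cantor.to_nat (i, n).

Lemma pair_index_surj m : exists i n, m = pair_index i n.
Proof.
exists (Cantor.of_nat m).1, (Cantor.of_nat m).2.
by rewrite /pair_index -surjective_pairing Cantor.cancel_to_of.
Qed.

Lemma leq_pair_index i n : (i + n <= pair_index i n)%N.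
Proof.
by rewrite addnC; apply/ssrnat.leP; exact: Cantor.to_nat_non_decreasing.
Qed.

Lemma pair_index_leq i n : (pair_index i n < (i.+1 * n.+1) ^ 2)%N.
Proof.
have := Cantor.to_nat_spec i n; rewrite -/(pair_index i n).
move: (pair_index i n) => m; rewrite expnS expn1; nia.
Qed.

(** The rows of a continuous linear map into the rapidly decreasing double
    sequences. *)
Definition rapid_family E (F : nat -> E -> s K) :=
  (forall i, linear (F i)) /\
  forall k e, 0 < e ->
    nbhs 0 [set v | forall i, s_ball 0 k (e / i.+1%:R ^+ k) (F i v)].

(** Since the pairing of i and n is less than ((i+1)(n+1))^2, the k-th norm of
    the glued sequence is controlled by the decay of the rows at order 2k. *)
Lemma rapid_family_glue E (F : nat -> E -> s K) : rapid_family F ->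
  exists f : E -> s K, continuous_linear f /\
    forall v i n, f v (pair_index i n) = F i v n.
Proof.
move=> [lF rF].
have [|k e e0|f [cf ef]] := s_valued_map archimedean
  (phi := fun m v => F (Cantor.of_nat m).1 v (Cantor.of_nat m).2).
- by move=> m a x y; rewrite lF.
- apply: filterS (rF (2 * k)%N e e0) => v h m /=.
  have [i [n ->]] := pair_index_surj m.
  rewrite /pair_index Cantor.cancel_of_to/= -/(pair_index i n).
  have /s_ball0/(_ n) := h i.
  rewrite ler_pdivlMr ?exprn_gt0//; apply: le_trans.
  rewrite -mulrA ler_wpM2l// -exprMn exprM.
  rewrite lerXn2r ?nnegrE ?exprn_ge0 ?mulr_ge0//.
  by rewrite -natrM -natrX ler_nat mulnC pair_index_leq.
- exists f; split => // v i n; rewrite ef.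
  by rewrite /pair_index Cantor.cancel_of_to.
Qed.

Lemma rapid_family_rows : exists F : nat -> s K -> s K,
  [/\ rapid_family F, forall i, continuous_linear (F i)
    & forall i x n, F i x n = x (pair_index i n)].
Proof.
have /choice[F hF] i := @s_reindex (pair_index i)
  (fun n => leq_trans (leq_addl i n) (leq_pair_index i n)).
exists F; split => [|i|i]; [|exact: (hF i).1|exact: (hF i).2].
split => [i|k e e0]; first exact: (hF i).1.1.
apply: filterS (nbhs_s_ball (k + k) e0) => x /s_ball0 h i.
apply/s_ball0 => n; rewrite (hF i).2 ler_pdivlMr ?exprn_gt0//.
apply: le_trans (h (pair_index i n)).
rewrite -mulrA ler_wpM2l// exprD ler_pM ?exprn_ge0//.
  rewrite lerXn2r ?nnegrE// ler_nat ltnS.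
  exact: leq_trans (leq_addl i n) (leq_pair_index i n).
rewrite lerXn2r ?nnegrE// ler_nat ltnS.
exact: leq_trans (leq_addr n i) (leq_pair_index i n).
Qed.

Lemma s_ballD k (e d : K) (x y : s K) :
  s_ball 0 k e x -> s_ball 0 k d y -> s_ball 0 k (e + d) (x + y).
Proof.
move=> /s_ball0 hx /s_ball0 hy; apply/s_ball0 => n.
apply: le_trans (lerD (hx n) (hy n)).
by rewrite -mulrDl ler_wpM2r ?exprn_ge0// ler_normD.
Qed.

Lemma rapid_familyD E (F G : nat -> E -> s K) :
  rapid_family F -> rapid_family G -> rapid_family (fun i v => F i v + G i v).
Proof.
move=> [lF rF] [lG rG]; split => [i a x y|k e e0].
  by rewrite lF lG scalerDr addrACA.
have e2 : 0 < e / 2 by rewrite divr_gt0.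
apply: filterS2 (rF k _ e2) (rG k _ e2) => v hF hG i.
by rewrite [e in e / _]splitr mulrDl; apply: s_ballD.
Qed.

Lemma rapid_familyN E (F : nat -> E -> s K) :
  rapid_family F -> rapid_family (fun i v => - F i v).
Proof.
move=> [lF rF]; split => [i a x y|k e e0]; first by rewrite lF opprD scalerN.
apply: filterS (rF k e e0) => v h i; apply/s_ball0 => n /=.
by rewrite normrN; move: n; exact/s_ball0.
Qed.

(** Continuity of [A] trades the order k for some order l, so the decay of [F] is
    needed at an order above both. *)
Lemma rapid_family_comp E (F : nat -> E -> s K) (A : s K -> s K) :
  continuous_linear A -> rapid_family F -> rapid_family (fun i => A \o F i).
Proof.
move=> cA [lF rF]; split => [i a x y|k e e0]; first by rewrite /= lF cA.1.
have [l [d [d0 dA]]] := continuous_linear0 cA (nbhs_s_ball k e0).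
apply: filterS (rF (maxn k l) d d0) => v h i /=.
have i0 : (0 : K) < i.+1%:R ^+ k by rewrite exprn_gt0.
have /dA/= h1 : s_ball 0 l d (i.+1%:R ^+ k *: F i v).
  apply: s_ballS (leq_maxr k l) _ _ (s_ballZ i0 (h i)).
  rewrite mulrCA ler_piMr ?(ltW d0)// ler_pdivrMr ?exprn_gt0// mul1r.
  by rewrite ler_weXn2l ?ler1n// leq_maxl.
have it0 : (0 : K) < (i.+1%:R ^+ k)^-1 by rewrite invr_gt0.
have := s_ballZ it0 h1.
by rewrite (scalable_linear cA.1) scalerA mulVf ?gt_eqF// scale1r mulrC.
Qed.

Lemma rapid_family_unshift E (F : nat -> E -> s K) :
  rapid_family F -> rapid_family (fun i => F i.+1).
Proof.
move=> [lF rF]; split => [i a x y|k e e0]; first by rewrite lF.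
apply: filterS (rF k e e0) => v h i.
apply: s_ballS (leqnn k) _ _ (h i.+1).
rewrite ler_pM2l// lef_pV2 ?posrE ?exprn_gt0//.
by rewrite lerXn2r ?nnegrE// ler_nat.
Qed.

Lemma rapid_family_shift E (F : nat -> E -> s K) : rapid_family F ->
  rapid_family (fun i v => if i is i'.+1 then F i' v else 0).
Proof.
move=> [lF rF]; split => [[|i] a x y|k e e0]; rewrite ?scaler0 ?addr0 ?lF//.
have e2 : 0 < e / 2 ^+ k by rewrite divr_gt0 ?exprn_gt0.
apply: filterS (rF k _ e2) => v h [|i].
  by apply: s_ball_refl; rewrite expr1n divr1 ltW.
apply: s_ballS (leqnn k) _ _ (h i).
rewrite -mulrA -invfM ler_pM2l// lef_pV2 ?posrE ?mulr_gt0 ?exprn_gt0//.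
rewrite -exprMn lerXn2r ?nnegrE ?mulr_ge0//.
by rewrite -natrM ler_nat; lia.
Qed.

Lemma rapid_family_head E (A : E -> s K) : continuous_linear A ->
  rapid_family (fun i v => if i is _.+1 then 0 else A v).
Proof.
move=> cA; split => [[|i] a x y|k e e0]; rewrite ?scaler0 ?addr0 ?cA.1//.
apply: filterS (continuous_linear0 cA (nbhs_s_ball k e0)) => v h [|i].
  by rewrite expr1n divr1.
by apply: s_ball_refl; rewrite divr_ge0 ?exprn_ge0// ltW.
Qed.

End Reindexing.

(** * Pelczynski decomposition *)

Section Decomposition.
Variable K : numFieldType.
Hypothesis archimedean : forall x : K, exists n : nat, `|x| <= n%:R.
Variable E : topologicalLmodType K.

(** An Eilenberg swindle. With Q := j pi, and [s] regarded as the space of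
    rapidly decreasing sequences of rows in [s], the map sends (e, y) to the
    sequence z_0 = j e + (1 - Q) y_0, z_(i+1) = Q y_i + (1 - Q) y_(i+1), and its
    inverse is e = pi z_0, y_i = Q z_(i+1) + (1 - Q) z_i. *)
Lemma complemented_absorbed (j : E -> s K) (pi : s K -> E) :
  continuous_linear j -> continuous_linear pi -> cancel j pi ->
  isomorphic (E * s K)%type (s K).
Proof.
move=> cj cpi jK.
have [R [rR cR eR]] := rapid_family_rows archimedean.
pose Q := j \o pi.
have cQ : continuous_linear Q by exact: continuous_linear_comp.
have QK x : Q (Q x) = Q x by rewrite /Q /= jK.
have rQ := rapid_family_comp cQ rR.
have rQ' := rapid_familyD rR (rapid_familyN rQ).
have [f1 [cf1 ef1]] := rapid_family_glue archimedean (rapid_family_head cj).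
have [f2 [cf2 ef2]] := rapid_family_glue archimedean
  (rapid_familyD (rapid_family_shift rQ) rQ').
have [g2 [cg2 eg2]] := rapid_family_glue archimedean
  (rapid_familyD (rapid_family_unshift rQ) rQ').
have row_eq x y : (forall i, R i x = R i y) -> x = y.
  move=> xy; apply/s_eqP => m; have [i [n ->]] := pair_index_surj m.
  by rewrite -!eR xy.
have BE u v n : (u - v : s K) n = u n - v n by [].
have DE u v n : (u + v : s K) n = u n + v n by [].
have Rf1 i x : R i (f1 x) = if i is _.+1 then 0 else j x.
  by apply/s_eqP => n; rewrite eR ef1.
have Rf2 i y : R i (f2 y) =
    (if i is i'.+1 then Q (R i' y) else 0) + (R i y - Q (R i y)).
  by apply/s_eqP => n; rewrite eR ef2.
have Rg2 i z : R i (g2 z) = Q (R i.+1 z) + (R i z - Q (R i z)).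
  by apply/s_eqP => n; rewrite eR eg2.
have RD i := linear_funD (cR i).1.
have QD := linear_funD cQ.1.
have Q0 := linear_fun0 cQ.1.
have QN := linear_funN cQ.1.
have Qj x : Q (j x) = j x by rewrite /Q /= jK.
eexists; apply: (prod_isomorphism cf1 cf2
  (continuous_linear_comp (cR 0%N) cpi) cg2) => [x y|x y|z] /=.
- rewrite RD Rf1 Rf2 add0r (linear_funD cpi.1) jK.
  by rewrite (zmod_morphism_linear cpi.1) /Q /= jK subrr addr0.
- apply: row_eq => i; rewrite Rg2 !RD !Rf1 !Rf2.
  case: i => [|i]; rewrite ?add0r !(QD, QN, QK, Q0, Qj) !subrr !addr0 ?add0r.
    by rewrite [j x + _]addrC addrK addrC subrK.
  by rewrite [Q (R i y) + _]addrC addrK addrC subrK.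
- apply: row_eq => i; rewrite RD Rf1 Rf2 Rg2.
  case: i => [|i]; rewrite ?Rg2 !(QD, QN, QK, Q0, Qj) !subrr !addr0 ?add0r.
    by rewrite [Q _ + (R 0%N z - _)]addrC addrK addrC subrK.
  by rewrite [Q _ + (R _ z - _)]addrC addrK addrC subrK.
Qed.

(** Since [E] is the sum of ker S and a copy T(s) of [s], and [s] is its own
    square, a second copy of [s] can be merged into T(s). *)
Lemma complement_absorbs (T : s K -> E) (S : E -> s K) :
  continuous_linear T -> continuous_linear S -> cancel T S ->
  isomorphic (E * s K)%type E.
Proof.
move=> cT cS TK.
have [A [B [A' [B' [[cA cB cA' cB'] [AK BK AB _]]]]]] :=
  s_interleave archimedean.
have cTS := continuous_linearN (continuous_linear_comp cS cT).
have cI := continuous_linearD (continuous_linear_id E) cTS.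
have cSA := continuous_linear_comp (continuous_linear_comp cS cA) cT.
have cSA' := continuous_linear_comp (continuous_linear_comp cS cA') cT.
have TD := linear_funD cT.1.
have SD := linear_funD cS.1.
have SN := linear_funN cS.1.
eexists; apply: (prod_isomorphism
  (continuous_linearD cI cSA) (continuous_linear_comp cB cT)
  (continuous_linearD cI cSA') (continuous_linear_comp cS cB')) => /=.
- move=> x y; rewrite !(SD, SN, TK) ?subrr add0r AK TD.
  by rewrite -[X in X - _]addrA addrK subrK.
- by move=> x y; rewrite !(SD, SN, TK) ?subrr add0r BK.
- move=> z; rewrite !(SD, SN, TK) ?subrr add0r addrK -addrA -TD AB.
  by rewrite subrK.
Qed.

Lemma pelczynski_decomposition (j : E -> s K) (pi : s K -> E)
    (T : s K -> E) (S : E -> s K) :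
  continuous_linear j -> continuous_linear pi -> cancel j pi ->
  continuous_linear T -> continuous_linear S -> cancel T S ->
  isomorphic E (s K).
Proof.
move=> cj cpi jK cT cS TK.
exact: isomorphic_trans (isomorphic_sym (complement_absorbs cT cS TK))
  (complemented_absorbed cj cpi jK).
Qed.

End Decomposition.

(** * Semi-inner products *)

Section SemiInnerProducts.
Variables (K : numFieldType) (conj : K -> K).
Hypothesis conj_ok : conjugation conj.

Lemma conjB x y : conj (x - y) = conj x - conj y.
Proof. by case: conj_ok. Qed.

Lemma conjM x y : conj (x * y) = conj x * conj y.
Proof. by case: conj_ok. Qed.

Lemma conjK : involutive conj.
Proof. by case: conj_ok. Qed.

Lemma conj_normK x : x * conj x = `|x| ^+ 2.
Proof. by case: conj_ok. Qed.

Lemma conj0 : conj 0 = 0.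
Proof. by rewrite -[X in conj X](subrr 0) conjB subrr. Qed.

Lemma conjD x y : conj (x + y) = conj x + conj y.
Proof. by rewrite -{1}[y]opprK conjB -sub0r conjB conj0 sub0r opprK. Qed.

Lemma norm_conj x : `|conj x| = `|x|.
Proof.
apply: (@pexpIrn _ 2); rewrite ?nnegrE//.
by rewrite -!conj_normK conjK mulrC.
Qed.

Lemma ge0_conj x : 0 <= x -> conj x = x.
Proof.
move=> x0; have [->|xn0] := eqVneq x 0; first exact: conj0.
by apply: (mulfI xn0); rewrite conj_normK ger0_norm.
Qed.

Variable E : lmodType K.

Definition semi_inner (B : E -> E -> K) :=
  [/\ forall z, linear (fun x => B x z : K^o), forall x y, B x y = conj (B y x)
    & forall x, 0 <= B x x].

Section Theory.
Variable B : E -> E -> K.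
Hypothesis iB : semi_inner B.

Lemma semi_inner_sym x y : B x y = conj (B y x). Proof. by case: iB. Qed.

Lemma semi_inner_ge0 x : 0 <= B x x. Proof. by case: iB. Qed.

Lemma semi_innerBl x y z : B (x - y) z = B x z - B y z.
Proof. by case: iB => lB _ _; exact: (zmod_morphism_linear (lB z)). Qed.

Lemma semi_innerDl x y z : B (x + y) z = B x z + B y z.
Proof. by case: iB => lB _ _; exact: (linear_funD (lB z)). Qed.

Lemma semi_innerZl a x z : B (a *: x) z = a * B x z.
Proof. by case: iB => lB _ _; exact: (scalable_linear (lB z)). Qed.

Lemma semi_inner_suml (I : Type) (r : seq I) (P : pred I) (F : I -> E) z :
  B (\sum_(i <- r | P i) F i) z = \sum_(i <- r | P i) B (F i) z.
Proof. by case: iB => lB _ _; exact: (linear_fun_sum (lB z)). Qed.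

Lemma semi_innerBr x y z : B z (x - y) = B z x - B z y.
Proof. by rewrite semi_inner_sym semi_innerBl conjB -!semi_inner_sym. Qed.

Lemma semi_innerDr x y z : B z (x + y) = B z x + B z y.
Proof. by rewrite semi_inner_sym semi_innerDl conjD -!semi_inner_sym. Qed.

Lemma semi_innerZr a x z : B z (a *: x) = conj a * B z x.
Proof. by rewrite semi_inner_sym semi_innerZl conjM -semi_inner_sym. Qed.

(** Both cases of [cauchy_schwarz] express that this square is nonnegative. *)
Lemma semi_inner_square a b x y :
  B (a *: x - b *: y) (a *: x - b *: y) =
  `|a| ^+ 2 * B x x - a * conj b * B x y - b * conj a * conj (B x y)
  + `|b| ^+ 2 * B y y.
Proof.
rewrite semi_innerBl !semi_innerBr !semi_innerZl !semi_innerZr.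
rewrite -!conj_normK (semi_inner_sym y x) !mulrA opprD opprK !addrA.
by [].
Qed.

Lemma cauchy_schwarz x y : `|B x y| ^+ 2 <= B x x * B y y.
Proof.
set a := B x x; set b := B y y; set c := B x y.
have a0 : 0 <= a by exact: semi_inner_ge0.
have b0 : 0 <= b by exact: semi_inner_ge0.
have [bz|bn0] := eqVneq b 0.
  rewrite bz mulr0; have [->|cn0] := eqVneq c 0.
    by rewrite normr0 expr0n.
  (* If [B y y = 0], the square at [x - t c y] is [a - 2 t |c|^2], and this
     choice of [t] makes it negative. *)
  exfalso; pose t := (a + 1) / `|c| ^+ 2.
  have c0 : 0 < `|c| ^+ 2 by rewrite exprn_gt0// normr_gt0.
  have t0 : 0 <= t by rewrite divr_ge0 ?ltW// ltr_wpDl.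
  have := semi_inner_ge0 (1 *: x - (t * c) *: y).
  rewrite semi_inner_square -/a -/b -/c bz mulr0 addr0 normr1 expr1n mul1r.
  rewrite (ge0_conj (@ler01 K)) !mul1r mulr1 conjM (ge0_conj t0).
  rewrite -!mulrA [conj c * c]mulrC conj_normK mulVf ?gt_eqF// mulr1.
  have -> : a - (a + 1) - (a + 1) = - (a + 2) by ring.
  by rewrite oppr_ge0 lt_geF// ltr_wpDl.
have b1 : 0 < b by rewrite lt_neqAle eq_sym bn0.
(* The projection of [x] off [y], multiplied by [b] to avoid a division. *)
have := semi_inner_ge0 (b *: x - c *: y).
rewrite semi_inner_square -/a -/b -/c (ge0_conj b0) ger0_norm//.
have -> : b ^+ 2 * a - b * conj c * c - c * b * conj c + `|c| ^+ 2 * b =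
    b * (a * b - `|c| ^+ 2) by rewrite -conj_normK; ring.
by rewrite pmulr_rge0// subr_ge0.
Qed.

Lemma semi_inner_seminorm (p : E -> K) : (forall x, 0 <= p x) ->
  (forall x, p x ^+ 2 = B x x) -> seminorm p.
Proof.
move=> p0 pB; split=> // [x y|a x].
  rewrite -(ler_pXn2r (n := 2)) ?nnegrE ?addr_ge0// pB sqrrD !pB.
  rewrite semi_innerDl !semi_innerDr -!addrA lerD2l.
  rewrite !addrA lerD2r (semi_inner_sym y x).
  have cs : `|B x y| <= p x * p y.
    rewrite -(ler_pXn2r (n := 2)) ?nnegrE ?mulr_ge0// exprMn !pB.
    exact: cauchy_schwarz.
  (* A difference of values of [B] on the diagonal. *)
  have rc : B x y + conj (B x y) \is Num.real.
    have := semi_inner_ge0 (x + y).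
    rewrite semi_innerDl !semi_innerDr (semi_inner_sym y x).
    move=> /ger0_real h.
    have hx := ger0_real (semi_inner_ge0 x).
    have hy := ger0_real (semi_inner_ge0 y).
    rewrite (_ : B x y + conj (B x y) =
      B x x + B x y + (conj (B x y) + B y y) - B x x - B y y); last by ring.
    by rewrite !rpredB.
  apply: le_trans (real_ler_norm rc) _; apply: le_trans (ler_normD _ _) _.
  by rewrite norm_conj lerD.
apply: (@pexpIrn _ 2); rewrite ?nnegrE ?mulr_ge0// exprMn !pB.
by rewrite semi_innerZl semi_innerZr mulrA conj_normK.
Qed.

End Theory.

(** The bundled forms in the definition of a hilbertian seminorm replaced by
    plain functions; that the seminorm property follows from the form lets
    hilbertian seminorms be built from it alone. *)
Lemma hilbertianP (p : E -> K) : hilbertian conj p <->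
  (forall x, 0 <= p x) /\
  exists B, semi_inner B /\ forall x, p x ^+ 2 = B x x.
Proof.
split=> [[sp [h [h0 hp]]]|[p0 [B [iB pB]]]].
  split; first exact: seminorm_ge0; exists h; split => //.
  split=> // [z a x y|x y]; first by rewrite linearDl linearZl_LR.
  by have := @hermitian_subproof K E false conj h x y; rewrite expr0 mul1r.
split; first exact: (semi_inner_seminorm iB p0 pB).
pose h : {hermitian E for false & conj} := HB.pack B
  (@isBilinear.Build K E E K *%R (conj \; *%R) B
    (fun z x y => semi_innerBl iB x y z) (fun z x y => semi_innerBr iB x y z)
    (fun z a x => semi_innerZl iB a x z) (fun z a x => semi_innerZr iB a x z))
  (@isHermitianSesquilinear.Build K E false conj B
    (fun x y => etrans (semi_inner_sym iB x y) (esym (mul1r _)))).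
by exists h; split=> [x|x]; [exact: (semi_inner_ge0 iB x)|exact: pB].
Qed.

End SemiInnerProducts.

(** * Normwise stability of the sequence space *)

Section Limits.
Variable K : numFieldType.

(** The order of [K] is partial; still, a limit of nonnegative numbers is the
    limit of their absolute values. *)
Lemma limit_ge0 (u : nat -> K) (l : K) :
  (\forall n \near \oo, 0 <= u n) -> u @ \oo --> l -> 0 <= l.
Proof.
move=> u0 ul; suff -> : l = `|l| by [].
have nl : (fun n => `|u n|) @ \oo --> `|l| by exact: cvg_norm.
have un : u @ \oo --> `|l|.
  apply: cvg_trans nl; apply: near_eq_cvg; near=> n.
  by rewrite ger0_norm//; near: n.
exact: (cvg_unique (@norm_hausdorff K K^o) ul un).
Unshelve. all: by end_near. Qed.

Lemma limit_le (u v : nat -> K) (l m : K) : (forall n, u n <= v n) ->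
  u @ \oo --> l -> v @ \oo --> m -> l <= m.
Proof.
move=> uv ul vm; rewrite -subr_ge0.
apply: (limit_ge0 _ (@cvgB _ K^o _ _ _ _ _ _ _ vm ul)).
by apply: nearW => n /=; rewrite subr_ge0.
Qed.

Lemma double_cvg (u : nat -> K) (l : K) :
  u @ \oo --> l -> (fun n => u n.*2) @ \oo --> l.
Proof.
move=> ul; apply: cvg_comp ul => A [N _ NA]; exists N => // n /= Nn.
by apply: NA => /=; lia.
Qed.

End Limits.

Section HilbertNorms.
Variables (R : realType) (K : numFieldType) (conj : K -> K).
Hypothesis scalars : scalar_field R conj.

Let conj_ok := scalar_conj scalars.
Let archi := scalar_archimedean scalars.

Definition weighted_dot (k : nat) (x y : s K) (n : nat) : K :=
  x n * conj (y n) * n.+1%:R ^+ (2 * k).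

Lemma weighted_dot_diag k (x : s K) n :
  weighted_dot k x x n = (`|x n| * n.+1%:R ^+ k) ^+ 2.
Proof. by rewrite /weighted_dot (conj_normK conj_ok) mulnC exprM exprMn. Qed.

Definition s_dot k (x y : s K) : K := lim (series (weighted_dot k x y) @ \oo).

Lemma s_dot_cvg k x y : series (weighted_dot k x y) @ \oo --> s_dot k x y.
Proof.
have [M M0 xM] := s_bounded x k.
have [L L0 yL] := s_bounded y (k + 2).
apply: (scalar_series_cvg scalars (M := M * L)) => n.
rewrite ler_pdivlMr ?exprn_gt0// /weighted_dot !normrM normrX normr_nat.
rewrite (norm_conj conj_ok) mul2n -addnn exprD.
apply: le_trans (ler_pM _ _ (xM n) (yL n)); rewrite ?mulr_ge0 ?exprn_ge0//.
by rewrite exprD le_eqVlt; apply/orP; left; apply/eqP; ring.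
Qed.

Lemma s_dot_unique k x y l :
  series (weighted_dot k x y) @ \oo --> l -> s_dot k x y = l.
Proof.
move=> h; apply: (cvg_unique (@norm_hausdorff K K^o) _ h); exact: s_dot_cvg.
Qed.

Lemma s_dot_ge0 k x : 0 <= s_dot k x x.
Proof.
apply: (limit_ge0 _ (@s_dot_cvg k x x)); apply: nearW => n.
apply: sumr_ge0 => i _.
by rewrite weighted_dot_diag exprn_ge0// mulr_ge0// exprn_ge0.
Qed.

Lemma s_dot_semi_inner k : semi_inner conj (s_dot k).
Proof.
split=> [z a x y|x y|x]; last exact: s_dot_ge0.
- apply: s_dot_unique.
  have -> : series (weighted_dot k (a *: x + y) z) =
      (fun n => a * series (weighted_dot k x z) n +
                series (weighted_dot k y z) n).
    apply/funext => n; rewrite /series/= mulr_sumr -big_split/=.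
    apply: eq_bigr => i _; rewrite /weighted_dot.
    by rewrite (_ : (a *: x + y) i = a * x i + y i)//; ring.
  apply: (@cvgD _ K^o); last exact: s_dot_cvg.
  by apply: cvgM; [exact: cvg_cst|exact: s_dot_cvg].
- apply: s_dot_unique.
  have -> : series (weighted_dot k x y) = conj \o series (weighted_dot k y x).
    apply/funext => n; rewrite /series/=.
    rewrite (big_morph conj (conjD conj_ok) (conj0 conj_ok)).
    apply: eq_bigr => i _.
    rewrite /weighted_dot !(conjM conj_ok) (conjK conj_ok).
    have -> : conj (i.+1%:R ^+ (2 * k)) = i.+1%:R ^+ (2 * k).
      by rewrite (ge0_conj conj_ok) ?exprn_ge0.
    by ring.
  apply/cvgrPdist_lt => e e0.
  have /cvgrPdist_lt/(_ e e0) := @s_dot_cvg k y x.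
  by apply: filterS => n; rewrite /= -(conjB conj_ok) (norm_conj conj_ok).
Qed.

Lemma s_norm_subproof k x : exists y, 0 <= y /\ y ^+ 2 = s_dot k x x.
Proof. by have [y] := scalar_sqrt scalars (s_dot_ge0 k x); exists y. Qed.

Definition s_norm k x : K := sval (cid (s_norm_subproof k x)).

Lemma s_norm_ge0 k x : 0 <= s_norm k x.
Proof. by rewrite /s_norm; case: cid => y []. Qed.

Lemma s_normK k x : s_norm k x ^+ 2 = s_dot k x x.
Proof. by rewrite /s_norm; case: cid => y []. Qed.

Lemma s_norm_hilbertian k : hilbertian conj (s_norm k).
Proof.
apply/hilbertianP => //; split; first exact: s_norm_ge0.
by exists (s_dot k); split; [exact: s_dot_semi_inner|exact: s_normK].
Qed.

Lemma coordinate_le_s_norm k (x : s K) n : `|x n| * n.+1%:R ^+ k <= s_norm k x.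
Proof.
rewrite ler_sqr_nneg ?s_norm_ge0 ?mulr_ge0 ?exprn_ge0// s_normK.
rewrite -subr_ge0.
apply: (@limit_ge0 K
  (fun m => series (weighted_dot k x x) m - weighted_dot k x x n)).
  exists n.+1 => // m /= nm; rewrite subr_ge0 /series/=.
  rewrite (big_cat_nat _ (n := n.+1))//= big_nat_recr//= addrAC lerDr.
  by rewrite addr_ge0// sumr_ge0// => i _;
    rewrite weighted_dot_diag exprn_ge0// mulr_ge0// exprn_ge0.
rewrite weighted_dot_diag.
by apply: (@cvgB _ K^o); [exact: s_dot_cvg|exact: cvg_cst].
Qed.

(** The factor (n+1)^(-2) that the squares of the next sup norm provide is
    summable, with sum at most 2. *)
Lemma s_norm_le_ball k e (x : s K) :
  0 <= e -> s_ball 0 k.+1 e x -> s_norm k x <= 2 * e.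
Proof.
move=> e0 /s_ball0 xe.
rewrite ler_sqr_nneg ?s_norm_ge0 ?mulr_ge0// s_normK.
apply: (limit_le _ (@s_dot_cvg k x x) (cvg_cst _)) => n.
apply: (@le_trans _ _ (\sum_(0 <= i < n) e ^+ 2 * (i.+1%:R ^+ 2)^-1)).
  apply: ler_sum => i _; rewrite weighted_dot_diag.
  rewrite ler_pdivlMr ?exprn_gt0// -exprMn -mulrA -exprSr.
  by rewrite lerXn2r ?nnegrE// mulr_ge0// exprn_ge0.
rewrite -mulr_sumr exprMn mulrC ler_wpM2r ?exprn_ge0//.
apply: le_trans (sum_inv_sqr_le K (leq0n n)) _.
rewrite divr1; apply: (@le_trans _ _ 2).
  by rewrite lerBlDr lerDl divr_ge0.
by rewrite -natrX ler_nat.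
Qed.

Lemma s_norm_fundamental : fundamental_system s_norm.
Proof.
split=> [k|U]; first by have [] := s_norm_hilbertian k.
split=> [[k [e [e0 eU]]]|[k [e [e0 eU]]]].
  exists k, e; split=> // x /ltW xe; apply: eU; apply/s_ball0 => n.
  exact: le_trans (coordinate_le_s_norm k x n) xe.
have e4 : 0 < e / 4 by rewrite divr_gt0.
exists k.+1, (e / 4); split=> // x xe; apply: eU => /=.
apply: le_lt_trans (s_norm_le_ball (ltW e4) xe) _.
rewrite mulrCA gtr_pMr// ltr_pdivrMr// mul1r.
by rewrite ltr_nat.
Qed.

Lemma s_norm_homo k x : s_norm k x <= s_norm k.+1 x.
Proof.
rewrite ler_sqr_nneg ?s_norm_ge0// !s_normK.
apply: (limit_le _ (@s_dot_cvg k x x) (@s_dot_cvg k.+1 x x)) => n.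
apply: ler_sum => i _; rewrite !weighted_dot_diag.
rewrite lerXn2r ?nnegrE ?mulr_ge0 ?exprn_ge0// ler_wpM2l//.
by rewrite ler_weXn2l ?ler1n.
Qed.

(** The entries of [x] and [y] at n are moved to 2n and 2n+1, whose weights lie
    between the old one and 2^k times it. *)
Lemma s_norm_interleave k (x y z : s K) :
  (forall n, z n.*2 = x n /\ z n.*2.+1 = y n) ->
  s_norm k x ^+ 2 + s_norm k y ^+ 2 <= s_norm k z ^+ 2 <=
    (2 ^+ k) ^+ 2 * (s_norm k x ^+ 2 + s_norm k y ^+ 2).
Proof.
move=> zE; rewrite !s_normK.
have cz := double_cvg (@s_dot_cvg k z z).
have cxy : (fun n => series (weighted_dot k x x) n +
    series (weighted_dot k y y) n) @ \oo --> s_dot k x x + s_dot k y y.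
  by apply: (@cvgD _ K^o); exact: s_dot_cvg.
have ccxy : (fun n => (2 ^+ k) ^+ 2 * (series (weighted_dot k x x) n +
    series (weighted_dot k y y) n)) @ \oo -->
    (2 ^+ k) ^+ 2 * (s_dot k x x + s_dot k y y).
  by apply: cvgM => //; exact: cvg_cst.
have split_z n : series (weighted_dot k z z) n.*2 =
    \sum_(0 <= i < n) (weighted_dot k z z i.*2 + weighted_dot k z z i.*2.+1).
  rewrite /series/=; elim: n => [|n ih]; first by rewrite !big_geq.
  by rewrite doubleS !big_nat_recr//= ih addrA.
have lower (u v c : K) : 0 <= u -> 0 <= v -> u <= v -> (`|c| * u ^+ k) ^+ 2 <=
    (`|c| * v ^+ k) ^+ 2.
  move=> u0 v0 uv.
  by rewrite lerXn2r ?nnegrE ?mulr_ge0 ?exprn_ge0// ler_wpM2l// lerXn2r.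
apply/andP; split.
  apply: (limit_le _ cxy cz) => n; rewrite split_z /series/= -big_split/=.
  apply: ler_sum => i _; rewrite !weighted_dot_diag (zE i).1 (zE i).2.
  by apply: lerD; apply: lower => //; rewrite ler_nat; lia.
apply: (limit_le _ cz ccxy) => n.
rewrite split_z /series/= -big_split/= mulr_sumr.
apply: ler_sum => i _; rewrite !weighted_dot_diag (zE i).1 (zE i).2.
rewrite mulrDr -!exprMn !(mulrCA (2 ^+ k)) -!exprMn -!natrM.
by apply: lerD; apply: lower => //; rewrite ler_nat; lia.
Qed.

Lemma s_normwise_stable : exists (psi : s K * s K -> s K) (C : nat -> K),
  [/\ @isomorphism K (s K * s K)%type (s K) psi, forall k, 0 < C k
    & forall k x y, (C k)^-1 * (s_norm k x + s_norm k y) <=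
        s_norm k (psi (x, y)) <= C k * (s_norm k x + s_norm k y)].
Proof.
have [A [B [A' [B' [[cA cB cA' cB'] [AK BK AB eAB]]]]]] := s_interleave archi.
exists (fun z => A z.1 + B z.2), (fun k => 2 ^+ k.+1); split.
- exact: (prod_isomorphism cA cB cA' cB' AK BK AB).
- by move=> k; rewrite exprn_gt0.
move=> k x y /=.
have /andP[lo up] := s_norm_interleave k (eAB x y).
move: lo up (s_norm_ge0 k x) (s_norm_ge0 k y) (s_norm_ge0 k (A x + B y)).
move: (s_norm k x) (s_norm k y) (s_norm k (A x + B y)) => a b c lo up a0 b0 c0.
have ab0 : 0 <= a + b by rewrite addr_ge0.
apply/andP; split.
  rewrite mulrC ler_pdivrMr ?exprn_gt0//.
  apply: (@le_trans _ _ (c * 2)); last first.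
    by rewrite ler_wpM2l// exprS ler_peMr// exprn_ege1// ler1n.
  rewrite ler_sqr_nneg ?mulr_ge0// exprMn.
  apply: le_trans (_ : 2 * (a ^+ 2 + b ^+ 2) <= _).
    rewrite -subr_ge0 (_ : _ - _ = (a - b) ^+ 2); last by ring.
    by rewrite -real_normK ?exprn_ge0// rpredB// ger0_real.
  rewrite mulrC; apply: ler_pM => //; first by rewrite addr_ge0// exprn_ge0.
  by rewrite -natrX ler_nat.
rewrite ler_sqr_nneg ?mulr_ge0 ?exprn_ge0//.
apply: le_trans up _; rewrite exprMn.
apply: ler_pM; rewrite ?exprn_ge0 ?addr_ge0 ?exprn_ge0//.
  by rewrite lerXn2r ?nnegrE ?exprn_ge0// ler_weXn2l// ler1n.
by rewrite sqrrD addrAC lerDl mulrn_wge0// mulr_ge0.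
Qed.

Variable E : topologicalLmodType K.

(** Transport of the norms and of the map of [s_normwise_stable]. *)
Lemma isomorphic_s_normwise_stable :
  isomorphic E (s K) -> normwise_stable conj E.
Proof.
move=> [f [cf [g [cg fK gK]]]].
have clg : continuous_linear g.
  by split=> // a x y; apply: (can_inj fK); rewrite cf.1 !gK.
have [psi [C [[cpsi [phi [cphi psiK phiK]]] C0 psiC]]] := s_normwise_stable.
exists (fun k => s_norm k \o f); split.
- split=> [|k]; last first.
    have /(hilbertianP conj_ok)[p0 [B [iB pB]]] := s_norm_hilbertian k.
    apply/hilbertianP => //; split; first by move=> x; exact: p0.
    exists (fun x y => B (f x) (f y)); split; last by move=> x; exact: pB.
    case: iB => lB sB B0; split=> [z a x y|x y|x]; [|exact: sB|exact: B0].
    by rewrite cf.1 lB.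
  split=> [k|U].
    by apply: (seminorm_comp cf.1); have [] := s_norm_hilbertian k.
  have f0 := linear_fun0 cf.1.
  have g0 := linear_fun0 clg.1.
  split=> [U0|[k [e [e0 eU]]]].
    have [k [e [e0 eU]]] :=
      (s_norm_fundamental.2 _).1 (continuous_linear0 clg U0).
    by exists k, e; split=> // x /eU /=; rewrite fK.
  have := continuous_linear0 cf (fundamental_nbhs k s_norm_fundamental e0).
  by apply: filterS.
- by move=> k x; exact: s_norm_homo.
exists (fun z => g (psi (f z.1, f z.2))), C; split=> // [|k x y]; last first.
  by rewrite /= gK; exact: psiC.
split.
  split.
    move=> a x y.
    rewrite -clg.1 -cpsi.1; congr (g (psi _)).
    by rewrite /= !cf.1.
  move=> z; apply: (@continuous_comp _ (s K * s K)%type _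
    (fun z : E * E => (f z.1, f z.2)) (g \o psi)).
    by apply: continuous_pair_map; exact: cf.2.
  by apply: continuous_comp; [exact: cpsi.2|exact: cg].
exists (fun x => (g (phi (f x)).1, g (phi (f x)).2)); split.
- move=> x; have cphif : phi (f y) @[y --> x] --> phi (f x).
    by apply: (@continuous_comp _ _ _ f phi); [exact: cf.2|exact: cphi].
  apply: cvg_pair.
    apply: (@cvg_comp _ _ _ (fun y => (phi (f y)).1) g); last exact: cg.
    by apply: (@cvg_comp _ _ _ (phi \o f) fst); [exact: cphif|exact: cvg_fst].
  apply: (@cvg_comp _ _ _ (fun y => (phi (f y)).2) g); last exact: cg.
  by apply: (@cvg_comp _ _ _ (phi \o f) snd); [exact: cphif|exact: cvg_snd].
- by move=> [x y] /=; rewrite gK psiK /= !fK.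
- by move=> x /=; rewrite !gK -surjective_pairing phiK fK.
Qed.

End HilbertNorms.

(** * Orthogonal sequences of polynomial growth *)

Lemma kernel_vector (K : fieldType) (I : finType) (r : nat)
    (F : I -> 'I_r -> K) : (r < #|I|)%N ->
  exists2 c : I -> K, exists i, c i != 0 &
    forall t, \sum_i c i * F i t = 0.
Proof.
move=> rI; pose M : 'M[K]_(#|I|, r) := \matrix_(i, t) F (enum_val i) t.
have : kermx M != 0.
  rewrite -mxrank_eq0 mxrank_ker subn_eq0 -ltnNge.
  exact: leq_ltn_trans (rank_leq_col M) rI.
case/rowV0Pn => v /sub_kermxP vM /rV0Pn[i vi].
exists (fun x => v 0 (enum_rank x)).
  by exists (enum_val i); rewrite enum_valK.
move=> t; have := congr1 (fun A : 'rV_r => A 0 t) vM.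
rewrite !mxE => e; rewrite -[RHS]e.
rewrite (reindex (@enum_val I predT)) /=; last exact/onW_bij/enum_val_bij.
by apply: eq_bigr => k _; rewrite mxE enum_valK.
Qed.

Section Retractions.
Variable K : numFieldType.

(** If [P] projects onto the copy of [E], then [pi] is [P] followed by the inverse
    of the embedding. *)
Lemma complemented_retraction (E F : topologicalLmodType K) (A : set F) :
  complemented A -> isomorphic_to_subspace E A ->
  exists (j : E -> F) (pi : F -> E),
    [/\ continuous_linear j, continuous_linear pi & cancel j pi].
Proof.
move=> [P [cP PP rP]] [f [cf rf [g [cg fK]]]].
have AP x : A (P x) by rewrite -rP; exists x.
have fgP x : f (g (P x)) = P x.
  have [z _ <-] : range f (P x) by rewrite rf; exact: AP.
  by rewrite fK.
exists f, (g \o P); split=> //; last first.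
  move=> x /=; have [z _ zf] : range P (f x) by rewrite rP -rf; exists x.
  by rewrite -zf PP zf fK.
split=> [a x y|x U] /=.
  by apply: (can_inj fK); rewrite cf.1 !fgP cP.1.
move=> /(cg (P x)); rewrite /nbhs/= => gU.
have {}gU : within A (nbhs (P x)) (g @^-1` U).
  by rewrite (nbhs_subspace_in (AP x)).
have : nbhs x (P @^-1` [set y | A y -> U (g y)]) by exact: cP.2.
by apply: filterS => y /=; apply; exact: AP.
Qed.

End Retractions.

Section FundamentalSystems.
Variables (K : numFieldType) (E : topologicalLmodType K) (p : nat -> E -> K).
Hypothesis fp : fundamental_system p.

Lemma fundamental_separates (x : E) : hausdorff_space E ->
  (forall k e, 0 < e -> p k x <= e) -> x = 0.
Proof.
move=> hE px; apply/esym/hE => A B A0 Bx.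
have [k [e [e0 eA]]] := (fp.2 A).1 A0.
exists x; split; last exact: nbhs_singleton.
apply: eA => /=; have e20 : 0 < e / 2 by rewrite divr_gt0.
apply: le_lt_trans (px k _ e20) _.
by rewrite ltr_pdivrMr// ltr_pMr// ltr1n.
Qed.

(** The tails of a series dominated by 1/(i+1)^2; the case m = 0 bounds the
    partial sums. *)
Lemma seminorm_series_le (q : E -> K) (w : nat -> E) (M : K) m n : seminorm q ->
  (m <= n)%N -> (forall i, q (w i) <= M / i.+1%:R ^+ 2) ->
  q (\sum_(m <= i < n) w i) <= M * (2 / m.+1%:R).
Proof.
move=> sq mn wM; apply: le_trans (seminorm_sum sq _ _ _) _.
have M0 : 0 <= M.
  by have := le_trans (seminorm_ge0 sq _) (wM 0%N); rewrite expr1n divr1.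
apply: (@le_trans _ _ (\sum_(m <= i < n) M * (i.+1%:R ^+ 2)^-1)).
  by apply: ler_sum => i _; exact: wM.
rewrite -mulr_sumr ler_wpM2l//; apply: le_trans (sum_inv_sqr_le K mn) _.
by rewrite lerBlDr lerDl divr_ge0.
Qed.

Hypothesis archimedean : forall x : K, exists n : nat, `|x| <= n%:R.

Lemma complete_series (w : nat -> E) : complete_lmod E ->
  (forall k, exists M, forall n, p k (w n) <= M / n.+1%:R ^+ 2) ->
  exists x, forall k e, 0 < e ->
    exists N, forall n, (N <= n)%N -> p k (x - \sum_(0 <= i < n) w i) <= e.
Proof.
move=> cE wM; pose S n := \sum_(0 <= i < n) w i.
have tail k e : 0 < e ->
    exists N, forall m n, (N <= m)%N -> (m <= n)%N -> p k (S n - S m) < e.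
  move=> e0; have [M kM] := wM k.
  have M0 : 0 <= M.
    have := le_trans (seminorm_ge0 (fp.1 k) _) (kM 0%N).
    by rewrite expr1n divr1.
  have [N MN] := archimedean (M * 2 / e).
  exists N => m n Nm mn.
  have -> : S n - S m = \sum_(m <= i < n) w i.
    by rewrite /S (big_cat_nat (n := m) (p := n))//= addrAC subrr add0r.
  apply: le_lt_trans (seminorm_series_le (fp.1 k) mn kM) _.
  rewrite mulrA ltr_pdivrMr// [ltRHS]mulrC -ltr_pdivrMr//.
  rewrite ger0_norm in MN; last by rewrite divr_ge0 ?mulr_ge0// ltW.
  by apply: le_lt_trans MN _; rewrite ltr_nat ltnS.
have tail2 k e : 0 < e ->
    exists N, forall m n, (N <= m)%N -> (N <= n)%N -> p k (S n - S m) < e.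
  move=> /(tail k)[N hN]; exists N => m n Nm Nn.
  have [mn|/ltnW nm] := leqP m n; first exact: hN.
  by rewrite -(seminormN (fp.1 k)) opprB; exact: hN.
have [|x Sx] := cE (S @ \oo) _.
  move=> U /(fp.2 U)[k [e [e0 eU]]]; have [N hN] := tail2 k e e0.
  exists [set S n | n in [set n | (N <= n)%N]].
    by exists N => // n Nn; exists n.
  by move=> _ _ [m Nm <-] [n Nn <-]; apply: eU; exact: hN.
exists x => k e e0.
have /Sx[N _ hN] : nbhs x [set y | p k (x - y) < e].
  have h : nbhs 0 [set y | p k y < e] by exact: fundamental_nbhs.
  have := @shift_continuous K E (- x) x.
  rewrite /continuous_at addNr => /(_ _ h).
  move=> {}h; have {}h : nbhs x [set y | p k (- x + y) < e] by [].
  by apply: filterS h => y /=; rewrite -(seminormN (fp.1 k)) opprD opprK.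
by exists N => n Nn; apply/ltW; exact: hN.
Qed.

End FundamentalSystems.

Section Cube.
Variables (K : numFieldType) (E : topologicalLmodType K) (p : nat -> E -> K).
Hypothesis sp : forall k, seminorm (p k).
Variables (psi : E * E -> E) (C : nat -> K).
Hypothesis lpsi : linear psi.
Hypothesis C0 : forall k, 0 < C k.
Hypothesis psiC : forall k x y,
  (C k)^-1 * (p k x + p k y) <= p k (psi (x, y)) <= C k * (p k x + p k y).

(** Applying [psi] to the pairs (u_i, 0) and (0, u_i) doubles the family and costs
    a factor C_k. So there are subspaces of arbitrarily large dimension N on
    which every seminorm agrees, up to a power of N that depends on the seminorm
    only, with a fixed multiple of the l1 norm of the coordinates. *)
Lemma cube_subspace (v : E) (m : nat) :
  exists (I : finType) (u : I -> E), #|I| = (2 ^ m)%N /\ forall k (c : I -> K),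
    p k v * \sum_i `|c i| <= C k ^+ m * p k (\sum_i c i *: u i) /\
    p k (\sum_i c i *: u i) <= C k ^+ m * (p k v * \sum_i `|c i|).
Proof.
elim: m => [|m [I [u [cI hu]]]].
  exists unit, (fun=> v); split; first by rewrite card_unit.
  move=> k c; have E1 (V : nmodType) (F : unit -> V) : \sum_i F i = F tt.
    by rewrite (bigD1 tt)//= big1 ?addr0// => -[].
  by rewrite !E1 expr0 !mul1r (seminormZ (sp k)) mulrC.
exists (I + I)%type,
  (fun i => match i with inl i => psi (u i, 0) | inr i => psi (0, u i) end).
split; first by rewrite card_sum cI expnS mul2n addnn.
move=> k c.
have psiE x y : psi (x, y) = psi (x, 0) + psi (0, y).
  rewrite -(linear_funD lpsi).
  by rewrite (_ : (x, 0) + (0, y) = (x + 0, 0 + y))// addr0 add0r.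
have l1 : linear (fun x => psi (x, 0)).
  move=> a x y; rewrite -lpsi.
  by congr (psi (_, _)); rewrite /= scaler0 addr0.
have l2 : linear (fun x => psi (0, x)).
  move=> a x y; rewrite -lpsi.
  by congr (psi (_, _)); rewrite /= scaler0 addr0.
rewrite !big_sumType/=.
rewrite -(eq_bigr _ (fun i _ => scalable_linear l1 (c (inl i)) (u i))).
rewrite -(eq_bigr _ (fun i _ => scalable_linear l2 (c (inr i)) (u i))).
rewrite -(linear_fun_sum l1) -(linear_fun_sum l2) -psiE.
have [h1 h2] := hu k (c \o inl); have [h3 h4] := hu k (c \o inr).
set x := \sum_i _ *: _ in h1 h2 *; set y := \sum_i _ *: _ in h3 h4 *.
have /andP[lo up] := psiC k x y.
rewrite mulrDr exprSr; split.
  rewrite -mulrA; apply: le_trans (lerD h1 h3) _.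
  by rewrite -mulrDr ler_wpM2l ?exprn_ge0 ?(ltW (C0 k))// -ler_pdivrMl.
apply: le_trans up _; rewrite [C k ^+ m * C k]mulrC -mulrA ler_pM2l// mulrDr.
exact: lerD.
Qed.

Variable B : E -> E -> K.
Variable conj : K -> K.
Hypothesis iB : semi_inner conj B.

(** In the subspace of [cube_subspace] some nonzero vector satisfies the linear
    conditions. The estimates of the other seminorms do not depend on which one
    it is: both [p k x] and [p k1 x] are compared with the same l1 norm. *)
Lemma orthogonal_unit_vector (k1 : nat) (v : E) (m : nat) (l : seq E) :
  0 < p k1 v -> (size l < 2 ^ m)%N ->
  exists x, [/\ p k1 x = 1, forall y, y \in l -> B x y = 0
    & forall k, p k x <= (C k * C k1) ^+ m * (p k v / p k1 v)].
Proof.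
move=> v0 lm; have [I [u [cI hu]]] := cube_subspace v m.
have [|c [i ci] cB] := @kernel_vector K I (size l)
  (fun i t => B (u i) (nth 0 l t)) _; first by rewrite cI.
have s0 : 0 < \sum_i `|c i|.
  by rewrite (bigD1 i)//= ltr_pwDl ?normr_gt0// sumr_ge0.
set x := \sum_i c i *: u i.
have [h1 _] := hu k1 c; rewrite -/x in h1.
have C1 : 0 < C k1 ^+ m by rewrite exprn_gt0.
have x0 : 0 < p k1 x.
  by rewrite -(pmulr_rgt0 _ C1); apply: lt_le_trans h1; rewrite mulr_gt0.
exists ((p k1 x)^-1 *: x); split.
- by rewrite (seminormZ (sp k1)) gtr0_norm ?invr_gt0// mulVf ?gt_eqF.
- move=> y yl; rewrite (semi_innerZl iB) (semi_inner_suml iB).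
  have it : (index y l < size l)%N by rewrite index_mem.
  have := cB (Ordinal it); rewrite /= nth_index// => cy.
  rewrite (eq_bigr (fun i => c i * B (u i) y)) ?cy ?mulr0// => k _.
  by rewrite (semi_innerZl iB).
- move=> k; rewrite (seminormZ (sp k)) gtr0_norm ?invr_gt0//.
  rewrite mulrC ler_pdivrMr//; have [_ h2] := hu k c; rewrite -/x in h2.
  apply: le_trans h2 _; rewrite exprMn -!mulrA.
  rewrite ler_wpM2l ?exprn_ge0 ?(ltW (C0 k))//.
  rewrite mulrCA ler_wpM2l ?(seminorm_ge0 (sp k))//.
  by rewrite mulrCA ler_pdivlMl.
Qed.

Hypothesis archimedean : forall x : K, exists n : nat, `|x| <= n%:R.

(** The n-th vector has to satisfy 2n linear conditions, so it can be taken in a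
    subspace of dimension 2^m at most 4(n+1), and the factor
    (C_k C_k1)^m is then polynomial in n. *)
Lemma orthogonal_sequence (k1 : nat) (v : E) (w : nat -> E) : 0 < p k1 v ->
  exists x : nat -> E, [/\ forall n, p k1 (x n) = 1,
    forall n i, (i < n)%N -> B (x n) (x i) = 0,
    forall n i, (i < n)%N -> B (x n) (w i) = 0
    & forall k, exists D b, 0 < D /\ forall n, p k (x n) <= D * n.+1%:R ^+ b].
Proof.
(* The extra 2 gives 2 n < 2 ^ lg n <= 4 (n + 1). *)
move=> v0; pose lg n := (trunc_log 2 n.+1).+2.
have lg1 n : (2 * n < 2 ^ lg n)%N.
  rewrite expnS ltn_pmul2l//.
  by apply: leq_ltn_trans (trunc_log_ltn n.+1 _).
have lg2 n : (2 ^ lg n <= 4 * n.+1)%N.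
  rewrite /lg !expnS mulnA leq_pmul2l//.
  exact: trunc_logP.
have /choice[g hg] (l : seq E) : exists x, [/\ p k1 x = 1,
    forall y, y \in l ++ [seq w i | i <- iota 0 (size l)] -> B x y = 0
    & forall k, p k x <= (C k * C k1) ^+ lg (size l) * (p k v / p k1 v)].
  apply: orthogonal_unit_vector => //.
  by rewrite size_cat size_map size_iota addnn -mul2n.
(* [L n] lists the first [n] vectors. *)
pose L := fix L n := if n is n'.+1 then rcons (L n') (g (L n')) else [::].
have sL n : size (L n) = n by elim: n => //= n ih; rewrite size_rcons ih.
have gL i n : (i < n)%N -> g (L i) \in L n.
  elim: n => // n ih; rewrite ltnS leq_eqVlt /= mem_rcons inE.
  by case/orP => [/eqP->|/ih->]; rewrite ?eqxx ?orbT.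
exists (fun n => g (L n)); split => [n|n i ni|n i ni|k].
- by have [] := hg (L n).
- by have [_ + _] := hg (L n); apply; rewrite mem_cat gL.
- have [_ + _] := hg (L n); apply; rewrite mem_cat sL; apply/orP; right.
  by apply: map_f; rewrite mem_iota.
- have [a ha] := archimedean (C k * C k1).
  have c0 : 0 < C k * C k1 by rewrite mulr_gt0.
  have {}ha : C k * C k1 <= (2 ^ a)%:R :> K.
    rewrite gtr0_norm// in ha; apply: le_trans ha _.
    by rewrite ler_nat ltnW// ltn_expl.
  have q0 : 0 <= p k v / p k1 v.
    by rewrite divr_ge0 ?(seminorm_ge0 (sp k))// ltW.
  exists ((4 ^ a)%:R * (p k v / p k1 v + 1)), a; split.
    by rewrite mulr_gt0 ?ltr0n ?expn_gt0// ltr_wpDl.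
  move=> n; have [_ _ /(_ k)] := hg (L n); rewrite sL => /le_trans; apply.
  rewrite [leRHS]mulrAC.
  apply: ler_pM; rewrite ?exprn_ge0 ?(ltW c0)//; last by rewrite lerDl.
  apply: (@le_trans _ _ ((2 ^ a)%:R ^+ lg n)).
    by rewrite lerXn2r ?nnegrE// ltW.
  rewrite -!natrX -natrM ler_nat -expnM mulnC expnM -expnMn.
  by case: (posnP a) => [->|a0]; rewrite ?expn0// leq_exp2r// lg2.
Qed.

End Cube.

(** * A complemented copy of the sequence space *)

Section UnitSequences.
Variable K : numFieldType.
Hypothesis archimedean : forall x : K, exists n : nat, `|x| <= n%:R.

Lemma s_unit_subproof (i : nat) :
  (fun n => (n == i)%:R : K^o) \in @rapidly_decreasing K.
Proof.
apply: bounded_rapidly_decreasing => // k; exists (i.+1%:R ^+ k) => n.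
have [->|_] := eqVneq n i; first by rewrite normr1 mul1r.
by rewrite normr0 mul0r exprn_ge0.
Qed.

Definition s_unit i : s K := MkS (s_unit_subproof i).

(** Cutting off the first n coordinates gains any power of n. *)
Lemma s_tail_ball k l n M (y : s K) : 0 <= M -> s_ball 0 (k + l) M y ->
  s_ball 0 k (M / n.+1%:R ^+ l) (y - \sum_(0 <= i < n) y i *: s_unit i).
Proof.
move=> M0 /s_ball0 yM; apply/s_ball0 => m.
have coord (z : nat -> s K) :
    (\sum_(0 <= i < n) z i) m = \sum_(0 <= i < n) z i m.
  exact: (big_morph (fun x : s K => x m)).
have -> : (y - \sum_(0 <= i < n) y i *: s_unit i) m =
    if (m < n)%N then 0 else y m.
  have subE (u w : s K) : (u - w) m = u m - w m by [].
  rewrite subE coord.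
  have -> : \sum_(0 <= i < n) (y i *: s_unit i) m =
      \sum_(0 <= i < n | i == m) y i.
    rewrite [RHS]big_mkcond; apply: eq_bigr => i _.
    rewrite (_ : (y i *: s_unit i) m = y i * (m == i)%:R)// eq_sym.
    by case: eqP => _; rewrite ?mulr1 ?mulr0.
  case: ltnP => mn; last first.
    by rewrite big_nat_cond big1 ?subr0// => i /andP[/andP[_ im] /eqP e]; lia.
  by rewrite big_nat1_eq mn subrr.
case: ltnP => mn; first by rewrite normr0 mul0r divr_ge0 ?exprn_ge0.
rewrite ler_pdivlMr ?exprn_gt0//; apply: le_trans (yM m).
rewrite -mulrA exprD ler_wpM2l// ler_wpM2l ?exprn_ge0//.
by rewrite lerXn2r ?nnegrE// ler_nat.
Qed.

End UnitSequences.

Section OrthonormalSequence.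
Variables (R : realType) (K : numFieldType) (conj : K -> K).
Hypothesis scalars : scalar_field R conj.

Let conj_ok := scalar_conj scalars.
Let archi := scalar_archimedean scalars.

Variables (E : topologicalLmodType K) (p : nat -> E -> K).
Hypothesis fp : fundamental_system p.
Variables (k1 : nat) (B : E -> E -> K).
Hypothesis iB : semi_inner conj B.
Hypothesis pB : forall x, p k1 x ^+ 2 = B x x.
Variable x : nat -> E.
Hypothesis x1 : forall n, p k1 (x n) = 1.
Hypothesis ox : forall n i, (i < n)%N -> B (x n) (x i) = 0.

Let norm_coefficient z n : `|B z (x n)| <= p k1 z.
Proof.
rewrite ler_sqr_nneg ?(seminorm_ge0 (fp.1 k1))//.
apply: le_trans (cauchy_schwarz conj_ok iB _ _) _.
by rewrite -!pB x1 expr1n mulr1.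
Qed.

Lemma orthonormal_coefficient i n : B (x i) (x n) = (i == n)%:R.
Proof.
have [->|] := eqVneq i n; first by rewrite -pB x1 expr1n.
rewrite neq_ltn => /orP[ni|/ox//].
by rewrite (semi_inner_sym iB) ox// (conj0 conj_ok).
Qed.

(** The point of making [x n] orthogonal to the images of the first n unit
    sequences: the n-th coefficient of [z] depends only on the tail of [j z] from
    n on, and therefore decreases rapidly. *)
Lemma coefficient_map (j : E -> s K) (pi : s K -> E) :
  continuous_linear j -> continuous_linear pi -> cancel j pi ->
  (forall n i, (i < n)%N -> B (x n) (pi (s_unit archi i)) = 0) ->
  exists S : E -> s K, continuous_linear S /\ forall z n, S z n = B z (x n).
Proof.
move=> cj cpi jK xpi.
apply: (s_valued_map archi (phi := fun n z => B z (x n))) => [n|k e e0].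
  by case: iB => lB _ _; exact: lB.
have [l [D [D0 piD]]] := continuous_bound_of_s fp cpi k1.
have M0 : 0 < e / D by rewrite divr_gt0.
apply: filterS (continuous_linear0 cj (nbhs_s_ball (l + k) M0)) => z /= zM n.
have N0 : 0 < n.+1%:R ^+ k :> K by rewrite exprn_gt0.
have M1 : 0 < e / D / n.+1%:R ^+ k by rewrite divr_gt0.
have := piD _ _ M1 (s_tail_ball archi n (ltW M0) zM).
rewrite mulrA [D * _]mulrC divfK ?gt_eqF// ler_pdivlMr//.
apply: le_trans; rewrite ler_wpM2r ?(ltW N0)//.
apply: le_trans (norm_coefficient _ n).
(* The cut-off part of [j z] has image orthogonal to [x n]. *)
rewrite (zmod_morphism_linear cpi.1) jK (semi_innerBl iB).
rewrite (linear_fun_sum cpi.1) (semi_inner_suml iB).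
rewrite big_nat big1 ?subr0// => i /= ni.
rewrite (scalable_linear cpi.1) (semi_innerZl iB) (semi_inner_sym iB).
by rewrite xpi// (conj0 conj_ok) mulr0.
Qed.

Hypothesis cE : complete_lmod E.
Hypothesis hE : hausdorff_space E.
Hypothesis xp : forall k, exists D b, 0 < D /\
  forall n, p k (x n) <= D * n.+1%:R ^+ b.

Lemma coefficient_bound k : exists D b, 0 < D /\
  forall M (a : s K) n, s_ball 0 b M a ->
    p k (a n *: x n) <= (D * M) / n.+1%:R ^+ 2.
Proof.
have [D [b [D0 xD]]] := xp k; exists D, (b + 2)%N; split=> // M a n /s_ball0 aM.
rewrite (seminormZ (fp.1 k)) ler_pdivlMr ?exprn_gt0//.
apply: (@le_trans _ _ (`|a n| * (D * n.+1%:R ^+ b) * n.+1%:R ^+ 2)).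
  by rewrite ler_wpM2r ?exprn_ge0// ler_wpM2l.
rewrite (_ : _ * _ * _ = D * (`|a n| * n.+1%:R ^+ (b + 2))).
  by rewrite ler_pM2l.
by rewrite exprD; ring.
Qed.

(** The series of the a_n x_n converges since the x_n grow polynomially; its
    coefficients are the a_n by orthonormality. *)
Lemma synthesis_map : exists T : s K -> E, continuous_linear T /\
  forall a n, B (T a) (x n) = a n.
Proof.
pose P (a : s K) n := \sum_(0 <= i < n) a i *: x i.
have /choice[T hT] (a : s K) : exists y, forall k e, 0 < e ->
    exists N, forall n, (N <= n)%N -> p k (y - P a n) <= e.
  apply: complete_series => // k.
  have [D [b [D0 aD]]] := coefficient_bound k.
  have [M M0 aM] := s_bounded a b.
  by exists (D * M) => n; apply: aD; apply/s_ball0.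
have lT : linear T.
  move=> t a b; apply/eqP; rewrite -subr_eq0; apply/eqP.
  apply: (fundamental_separates fp hE) => k e e0.
  have e3 : 0 < e / 3 by rewrite divr_gt0.
  have et : 0 < e / 3 / (`|t| + 1) by rewrite divr_gt0// ltr_wpDl.
  have [N1 h1] := hT (t *: a + b) k _ e3.
  have [N2 h2] := hT a k _ et.
  have [N3 h3] := hT b k _ e3.
  pose n := (N1 + N2 + N3)%N.
  have {}h1 := h1 n ltac:(lia); have {}h2 := h2 n ltac:(lia).
  have {}h3 := h3 n ltac:(lia).
  have Pn : P (t *: a + b) n = t *: P a n + P b n.
    rewrite /P scaler_sumr -big_split/=; apply: eq_bigr => i _.
    transitivity ((t * a i + b i) *: x i); first by [].
    by rewrite scalerDl scalerA.
  have -> : T (t *: a + b) - (t *: T a + T b) =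
      (T (t *: a + b) - P (t *: a + b) n) -
      (t *: (T a - P a n) + (T b - P b n)).
    by rewrite Pn scalerBr addrACA -opprD opprB addrA subrK.
  have e_split : e / 3 + (e / 3 + e / 3) = e by field.
  rewrite -[leRHS]e_split.
  apply: le_trans (seminormD (fp.1 k) _ _) _; apply: lerD => //.
  rewrite (seminormN (fp.1 k)).
  apply: le_trans (seminormD (fp.1 k) _ _) _; apply: lerD => //.
  rewrite (seminormZ (fp.1 k)).
  rewrite (@le_trans _ _ ((`|t| + 1) * (e / 3 / (`|t| + 1))))//.
    by rewrite ler_pM ?(seminorm_ge0 (fp.1 k))// lerDl.
  by rewrite mulrC divfK// gt_eqF// ltr_wpDl.
exists T; split.
  split=> //; apply: linear_continuous0 => // U /(fp.2 U)[k [e [e0 eU]]].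
  have [D [b [D0 aD]]] := coefficient_bound k.
  (* The partial sums are then bounded by 2 D e / (8 D) = e / 4. *)
  have M0 : 0 < e / (8 * D) by rewrite divr_gt0 ?mulr_gt0.
  apply: filterS (nbhs_s_ball b M0) => a aM; apply: eU => /=.
  have e4 : 0 < e / 4 by rewrite divr_gt0.
  have [N hN] := hT a k _ e4.
  have h1 : p k (P a N) <= e / 4.
    apply: le_trans (seminorm_series_le (fp.1 k) (leq0n N)
      (fun i => aD _ a i aM)) _.
    by rewrite le_eqVlt; apply/orP; left; apply/eqP; field; rewrite gt_eqF.
  rewrite -(subrK (P a N) (T a)); apply: le_lt_trans (seminormD (fp.1 k) _ _) _.
  apply: le_lt_trans (lerD (hN N (leqnn N)) h1) _.
  rewrite -mulrDr gtr_pMr// (_ : 4^-1 + 4^-1 = 2^-1 :> K); last by field.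
  by rewrite invf_lt1// ltr1n.
move=> a n; apply/eqP; rewrite -subr_eq0 -normr_eq0; apply/eqP.
apply: ge0_small_eq0 => // e e0.
have [N hN] := hT a k1 _ e0.
pose m := (N + n.+1)%N.
have := hN m (leq_addr _ _); apply: le_trans.
apply: le_trans (norm_coefficient _ n).
rewrite (semi_innerBl iB) (semi_inner_suml iB).
rewrite (eq_bigr (fun i => if i == n then a i else 0)); last first.
  move=> i _; rewrite (semi_innerZl iB) orthonormal_coefficient.
  by case: eqP => _; rewrite ?mulr1 ?mulr0.
by rewrite -big_mkcond big_nat1_eq /= /m addnS ltnS leq_addl.
Qed.

End OrthonormalSequence.

Theorem theorem2p2 (R : realType) (K : numFieldType) (conj : K -> K)
    (scalars : scalar_field R conj)
    (E : topologicalLmodType K) (E_fh : frechet_hilbert conj E)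
    (E_neq0 : exists x : E, x != 0) :
  isomorphic E (s K) <->
  (exists A : set (s K), complemented A /\ isomorphic_to_subspace E A) /\
  normwise_stable conj E.
Proof.
split=> [EiS|[[A [cA iA]] [p [[fp hp] _ [psi [C [ipsi C0 psiC]]]]]]].
  split; last exact: (isomorphic_s_normwise_stable scalars EiS).
  have [f [cf [g [cg fK gK]]]] := EiS.
  exists setT; split.
    exists id; split=> //; first exact: continuous_linear_id.
    by rewrite image_id.
  exists f; split=> //.
    by apply/seteqP; split=> // y _; exists (g y).
  by exists g; split=> //; exact: continuous_subspaceT.
have [[hE cE _] _] := E_fh.
have conj_ok := scalar_conj scalars.
pose archi := scalar_archimedean scalars.
have [j [pi [cj cpi jK]]] := complemented_retraction cA iA.
have [v v0] := E_neq0.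
(* The inner product used is that of a seminorm which does not vanish at [v]. *)
have [k1 pv] : exists k1, 0 < p k1 v.
  apply: contrapT => np; move/eqP: v0; apply.
  apply: (fundamental_separates fp hE) => k e e0.
  have [->|pn0] := eqVneq (p k v) 0; first exact: ltW.
  exfalso; apply: np; exists k.
  by rewrite lt_neqAle eq_sym pn0 (seminorm_ge0 (fp.1 k)).
have /(hilbertianP conj_ok)[_ [B [iB pB]]] := hp k1.
have [x [x1 ox xpi xp]] := orthogonal_sequence fp.1 ipsi.1.1 C0 psiC iB archi
  (fun i => pi (s_unit archi i)) pv.
have [S [cS eS]] := coefficient_map fp iB pB x1 cj cpi jK xpi.
have [T [cT eT]] := synthesis_map scalars fp iB pB x1 ox cE hE xp.
apply: (pelczynski_decomposition archi cj cpi jK cT cS).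
by move=> a; apply/s_eqP => n; rewrite eS eT.
Qed.
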